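(* Let $k,\ell$ be integers with $0\le\ell<k$ and let $L=\{\ell\}$. Then for all sufficiently large $n$, \[\vartheta(G(n,k,L))=1+\frac{\binom{k}{k-\ell}\binom{n-k}{k-\ell}}{\sum_{j=0}^{k-\ell}(-1)^{j+1}\binom{\ell+1}{j}\binom{k-\ell-1}{k-\ell-j}\binom{n-k-\ell-1}{k-\ell-j}},\] and this quantity equals $\frac{\binom{k}{k-\ell}}{(k-\ell)(\ell+1)}n+O(1)$ as $n\to\infty$. Similarly, if $L'=[0,k-1]\setminus\{\ell\}$, then as $n\to\infty$, \[\vartheta(G(n,k,L'))=\frac{\binom{n}{k}}{\vartheta(G(n,k,L))}=\frac{(\ell+1)(k-\ell)}{k!\binom{k}{k-\ell}}n^{k-1}+O(n^{k-2}).\]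
   Context: $[a,b]=\{a,\ldots,b\}$; $\binom{[n]}{k}$ is the family of $k$-subsets of $\{1,\ldots,n\}$. For $L\subset[0,k-1]$, the generalized Johnson graph $G(n,k,L)$ has vertex set $\binom{[n]}{k}$, with $A,B$ adjacent iff $|A\cap B|\notin L$. For a graph $G$ on $N$ vertices, the Lovász number is $\vartheta(G)=\max\sum_{i,j}b_{ij}$ over all $N\times N$ positive semidefinite matrices $B=(b_{ij})$ with trace $1$ and $b_{ij}=0$ whenever $ij$ is an edge. Here $k,\ell$ are fixed and $n\to\infty$. *)

(* Defs.v *)
From HB Require Import structures.
From mathcomp Require Import all_boot all_order all_algebra.
From mathcomp Require Import boolp classical_sets reals.
Set Implicit Arguments. Unset Strict Implicit. Unset Printing Implicit Defensive.
Import Order.TTheory GRing.Theory Num.Theory.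
Local Open Scope ring_scope.
Local Open Scope classical_set_scope.

Definition kset (n k : nat) := {A : {set 'I_n} | #|A| == k}.

Definition johnson_adj (n k : nat) (L : pred nat) (A B : kset n k) : bool :=
  (A != B) && ~~ L #|val A :&: val B|.

Definition psd (R : realType) (T : finType) (B : T -> T -> R) : Prop :=
  (forall i j, B i j = B j i) /\
  (forall x : T -> R, 0 <= \sum_i \sum_j x i * B i j * x j).

Definition theta_feasible (R : realType) (T : finType) (adj : rel T)
  (B : T -> T -> R) : Prop :=
  psd B /\ \sum_i B i i = 1 /\ (forall i j, adj i j -> B i j = 0).

(* Lovasz number: supremum (in fact a maximum) of sum_{i,j} b_ij *)
Definition lovasz_theta (R : realType) (T : finType) (adj : rel T) : R :=
  sup [set s : R | exists B, theta_feasible adj B /\ s = \sum_i \sum_j B i j].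

Definition theta_johnson (R : realType) (n k : nat) (L : pred nat) : R :=
  @lovasz_theta R (kset n k) (@johnson_adj n k L).

(* Main.v *)
Require Import Defs.
From HB Require Import structures.
From mathcomp Require Import all_boot all_order all_algebra.
From mathcomp Require Import boolp classical_sets reals.
From mathcomp Require Import fintype finset fingroup perm ring lra zify.
Set Implicit Arguments.
Unset Strict Implicit.
Unset Printing Implicit Defensive.
Import Order.TTheory GRing.Theory Num.Theory.
Local Open Scope ring_scope.

(* The classes {|A :&: B| = j} form the Johnson scheme.  A function on k-sets is
   a sum of functions A |-> sum over the i-subsets of A of a harmonic function h
   (one killed by S |-> sum_(x notin S) h (x |: S)), for i <= k; these
   components are pairwise orthogonal, and the relation |A :&: B| = l acts on the
   i-th one by the scalar given by Eberlein's alternating sum.  As n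
   grows, the smallest of these eigenvalues is the one of index l+1, which has
   order n^(k-l-1), while the largest, the degree D, has order n^(k-l).  Writing
   -lam for the smallest one, two positive semidefinite matrices settle both
   theta numbers at once: lam I + A_l - ((lam + D)/N) J, and the average over all
   permutations of v v^T for an eigenvector v of -lam.  Each of them is the
   optimum for one graph and, paired with an arbitrary feasible matrix, the upper
   bound for the other. *)

(** * Positive semidefinite pairing *)

Lemma psd_diag_ge0 (R : realType) (T : finType) (B : T -> T -> R) (a : T) :
  psd B -> 0 <= B a a.
Proof.
case=> _ /(_ (fun x => (x == a)%:R)).
rewrite (bigD1 a) //= [X in _ + X]big1 ?addr0 => [|x /negPf xa]; last first.
  by apply: big1 => y _; rewrite xa !mul0r.
rewrite (bigD1 a) //= big1 => [|y /negPf ya]; last by rewrite ya mulr0.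
by rewrite eqxx mul1r mulr1 addr0.
Qed.

(** The form evaluated at x + t e_a. The choice of t drives the next two lemmas. *)
Lemma psd_form_shift (R : realType) (T : finType) (B : T -> T -> R) (a : T)
    (x : T -> R) (t : R) : psd B ->
  0 <= \sum_i \sum_j x i * B i j * x j + t * (\sum_j B a j * x j) *+ 2
       + t ^+ 2 * B a a.
Proof.
case=> Bsym /(_ (fun i => x i + t * (i == a)%:R)).
have congr_ge0 (p q : R) : p = q -> 0 <= p -> 0 <= q by move=> ->.
apply: congr_ge0.
have D (F : T -> R) : \sum_i F i * (i == a)%:R = F a.
  rewrite (bigD1 a) //= eqxx mulr1 big1 ?addr0 // => i /negPf->.
  by rewrite mulr0.
have -> : \sum_i \sum_j (x i + t * (i == a)%:R) * B i j * (x j + t * (j == a)%:R)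
  = \sum_i (\sum_j x i * B i j * x j + t * (x i * B i a)
            + (t * \sum_j B i j * x j + t ^+ 2 * B i a) * (i == a)%:R).
  apply: eq_bigr => i _.
  transitivity (\sum_j (x i * B i j * x j + t * (i == a)%:R * (B i j * x j)
     + (t * (x i * B i j) + t ^+ 2 * (i == a)%:R * B i j) * (j == a)%:R)).
    by apply: eq_bigr => j _; ring.
  by rewrite big_split big_split /= D -mulr_sumr; ring.
rewrite big_split big_split /= D -mulr_sumr.
have -> : \sum_i x i * B i a = \sum_j B a j * x j.
  by apply: eq_bigr => i _; rewrite mulrC Bsym.
by ring.
Qed.

(** When B a a = 0, the form at e_j + t e_a is affine in t, so a nonzero slope 2 B a j would make it
    negative somewhere. *)
Lemma psd_row0 (R : realType) (T : finType) (B : T -> T -> R) (a j : T) :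
  psd B -> B a a = 0 -> B a j = 0.
Proof.
move=> Bpsd Baa; apply/eqP; case: eqP => // /eqP Baj.
(* This t brings the form down to -1. *)
have := @psd_form_shift _ _ B a (fun x => (x == j)%:R)
  (- (B j j + 1) / (2 * B a j)) Bpsd.
have D (F : T -> R) : \sum_i F i * (i == j)%:R = F j.
  rewrite (bigD1 j) //= eqxx mulr1 big1 ?addr0 // => i /negPf->.
  by rewrite mulr0.
under eq_bigr => i _ do rewrite D mulrC.
rewrite !D Baa.
have -> : B j j + - (B j j + 1) / (2 * B a j) * B a j *+ 2
   + (- (B j j + 1) / (2 * B a j)) ^+ 2 * 0 = -1 :> R by field.
by rewrite ler0N1.
Qed.

(** The form of the Schur complement at x is the minimum over t of the form of B at x + t e_a,
    attained at the t chosen below. *)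
Lemma psd_schur (R : realType) (T : finType) (B : T -> T -> R) (a : T) :
  psd B -> 0 < B a a -> psd (fun i j => B i j - B a i * B a j / B a a).
Proof.
move=> Bpsd Baa; have [Bsym _] := Bpsd; split=> [i j|x].
  by rewrite Bsym [B a i * _]mulrC.
have := psd_form_shift a x (- (\sum_j B a j * x j) / B a a) Bpsd.
have congr_ge0 (p q : R) : p = q -> 0 <= p -> 0 <= q by move=> ->.
apply: congr_ge0.
set s := \sum_j B a j * x j.
have -> : \sum_i \sum_j x i * (B i j - B a i * B a j / B a a) * x j
  = \sum_i \sum_j x i * B i j * x j - s ^+ 2 / B a a.
  have -> : s ^+ 2 / B a a = \sum_i \sum_j (B a i * x i) * (B a j * x j) / B a a.
    rewrite expr2 -mulrA {1}/s mulr_suml; apply: eq_bigr => i _.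
    rewrite /s. rewrite [in LHS]mulr_suml mulr_sumr; apply: eq_bigr => j _.
    by rewrite !mulrA; ring.
  rewrite -sumrB; apply: eq_bigr => i _; rewrite -sumrB; apply: eq_bigr => j _.
  by ring.
by field; rewrite gt_eqF.
Qed.

(** Induction on the number of nonzero diagonal entries of Z. Splitting off the rank-one matrix Z a
    i * Z a j / Z a a contributes the form of B at row a of Z, up to a positive factor; the Schur
    complement that remains has at least one more zero on its diagonal. *)
Lemma psd_pairing (R : realType) (T : finType) (B Z : T -> T -> R) :
  psd B -> psd Z -> 0 <= \sum_i \sum_j B i j * Z i j.
Proof.
move=> Bpsd; have [m] := ubnP #|[pred i | Z i i != 0]|.
elim: m Z => // m IHm Z; rewrite ltnS => leZ Zpsd.
have [a /= Zaa|Z0] := pickP [pred i | Z i i != 0]; last first.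
  rewrite big1 // => i _; rewrite big1 // => j _.
  by rewrite (psd_row0 j Zpsd) ?mulr0 //; apply/eqP/negbFE/Z0.
have Za_gt0 : 0 < Z a a by rewrite lt_def Zaa psd_diag_ge0.
have Z'psd := psd_schur Zpsd Za_gt0.
have {IHm} := IHm _ _ Z'psd; set Z' := (fun i j => _) in Z'psd *.
have -> : \sum_i \sum_j B i j * Z i j = \sum_i \sum_j B i j * Z' i j
   + (\sum_i \sum_j Z a i * B i j * Z a j) / Z a a.
  rewrite mulr_suml -big_split; apply: eq_bigr => i _.
  rewrite mulr_suml -big_split; apply: eq_bigr => j _.
  by rewrite /Z' /=; ring.
move=> IH; apply: addr_ge0; last by apply: divr_ge0 (ltW Za_gt0); apply: Bpsd.2.
apply: IH; apply: leq_trans leZ; apply: proper_card; apply/properP; split.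
  apply/subsetP => i; rewrite !inE /Z' /=; apply: contraNneq => Zii.
  have [Zsym _] := Zpsd.
  by rewrite Zii [Z a i]Zsym (psd_row0 a Zpsd Zii) !mul0r subrr.
by exists a; rewrite !inE ?Zaa //= /Z' mulfK ?subrr ?eqxx.
Qed.

Lemma sup_attained (R : realType) (S : set R) (s : R) :
  S s -> (forall t, S t -> t <= s) -> sup S = s.
Proof.
move=> Ss sub; apply/eqP; rewrite eq_le ge_sup //=; last by exists s.
by apply: sup_upper_bound => //; split; exists s.
Qed.

(* The matrix lam I + A - ((lam + D)/N) J certifies one upper bound and provides
   the optimum for the complementary graph; E does the same with the two graphs
   exchanged. *)
Lemma lovasz_theta_pair (R : realType) (T : finType) (a : rel T) (D lam : R)
    (E : T -> T -> R) :
  let N : R := #|T|%:R in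
  0 < N -> 0 < D -> 0 < lam ->
  symmetric a -> irreflexive a -> (forall x, \sum_y (a x y)%:R = D) ->
  psd (fun x y => lam * (x == y)%:R + (a x y)%:R - (lam + D) / N) ->
  psd E -> (forall x, E x x = 1) -> (forall x y, a x y -> E x y = - lam / D) ->
  \sum_x \sum_y E x y = 0 ->
  lovasz_theta R (fun x y => (x != y) && ~~ a x y) = 1 + D / lam /\
  lovasz_theta R a = N / (1 + D / lam).
Proof.
move=> N N0 D0 lam0 asym airr areg; set Z := (fun x y => _).
move=> Zpsd Epsd Ediag Ea Esum.
have NT : \sum_(x : T) (1 : R) = N by rewrite sumr_const -[RHS]mulr1 mulr_natl.
have sumdiag (F : T -> R) x : \sum_y F y * (x == y)%:R = F x.
  rewrite (bigD1 x) //= eqxx mulr1 big1 ?addr0 // => y.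
  by rewrite eq_sym => /negPf->; rewrite mulr0.
split; apply: sup_attained.
(* This matrix is Z + ((lam + D)/N) J divided by lam N, hence positive semidefinite. *)
- exists (fun x y => N^-1 * (x == y)%:R + (lam * N)^-1 * (a x y)%:R); split.
    split; [split|split].
    + by move=> i j; rewrite asym eq_sym.
    + move=> x; have /= := Zpsd.2 x.
      suff -> : \sum_i \sum_j x i * (N^-1 * (i == j)%:R
                 + (lam * N)^-1 * (a i j)%:R) * x j
        = (lam * N)^-1 * (\sum_i \sum_j x i * Z i j * x j)
          + (lam + D) / (lam * N ^+ 2) * (\sum_i x i) ^+ 2.
        move=> Zx; apply: addr_ge0; apply: mulr_ge0 => //.
          by rewrite invr_ge0 mulr_ge0 ?ltW.
          by rewrite divr_ge0 ?mulr_ge0 ?exprn_ge0 ?addr_ge0 ?ltW.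
        exact: sqr_ge0.
      rewrite mulr_sumr [(\sum_i x i) ^+ 2]expr2 mulr_suml mulr_sumr -big_split /=.
      apply: eq_bigr => i _; rewrite !mulr_sumr -big_split /=.
      apply: eq_bigr => j _; rewrite /Z; field.
      by rewrite !gt_eqF.
    + under eq_bigr => x _ do rewrite eqxx airr mulr1 mulr0 addr0.
      by rewrite sumr_const -[LHS]mulr_natr mulVf // gt_eqF.
    + by move=> i j /andP[/negPf-> /negPf->]; rewrite !mulr0 addr0.
  under eq_bigr => x _ do rewrite big_split /= sumdiag -mulr_sumr areg.
  rewrite sumr_const -[RHS]mulr_natl -/N; field.
  by rewrite !gt_eqF.
- move=> _ [B [[Bpsd [Btr Badj]] ->]].
  have := psd_pairing Bpsd Epsd.
  (* Off the diagonal B lives on the relation [a], where E is the constant -lam/D. *)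
  have -> : \sum_i \sum_j B i j * E i j
    = 1 - lam / D * (\sum_i \sum_j B i j - 1).
    rewrite -Btr -sumrB mulr_sumr -sumrB; apply: eq_bigr => i _.
    rewrite (bigD1 i) //= Ediag mulr1 [X in _ * (X - _)](bigD1 i) //=.
    rewrite [X in lam / D * X]addrAC subrr add0r mulr_sumr -sumrN; congr (_ + _).
    apply: eq_bigr => j ji; case aij : (a i j); first by rewrite Ea //; ring.
    by rewrite Badj ?mul0r ?mulr0 ?oppr0 // eq_sym ji aij.
  by rewrite subr_ge0 mulrAC ler_pdivrMr // mul1r -lterBDl -ler_pdivlMl //
     [_^-1 * _]mulrC.
(* D E + lam J vanishes on [a] and has diagonal D + lam; c scales its trace to 1. *)
- pose c := (lam + D)^-1 / N.
  exists (fun x y => c * (D * E x y + lam)); split.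
    split; [split|split].
    + by move=> i j; rewrite Epsd.1.
    + move=> x; have /= := Epsd.2 x.
      suff -> : \sum_i \sum_j x i * (c * (D * E i j + lam)) * x j
        = c * D * (\sum_i \sum_j x i * E i j * x j)
          + c * lam * (\sum_i x i) ^+ 2.
        move=> Ex; have c0 : 0 <= c.
          by rewrite /c mulr_ge0 ?invr_ge0 ?addr_ge0 ?ltW.
        by rewrite addr_ge0 // mulr_ge0 ?sqr_ge0 // mulr_ge0 // ltW.
      rewrite mulr_sumr [(\sum_i x i) ^+ 2]expr2 mulr_suml mulr_sumr -big_split /=.
      apply: eq_bigr => i _; rewrite !mulr_sumr -big_split /=.
      by apply: eq_bigr => j _; ring.
    + under eq_bigr => x _ do rewrite Ediag mulr1.
      rewrite sumr_const -[LHS]mulr_natl -/N /c; field.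
      by rewrite !gt_eqF ?addr_gt0.
    + by move=> i j aij; rewrite Ea //; field; rewrite gt_eqF.
  under eq_bigr => x _ do rewrite -mulr_sumr big_split /= -mulr_sumr.
  rewrite -mulr_sumr big_split /= -mulr_sumr Esum mulr0 add0r.
  rewrite !sumr_const -[X in c * X]mulr_natl -[X in c * (_ * X)]mulr_natl -/N /c.
  by field; rewrite !gt_eqF // ?addr_gt0 ?divr_gt0.
- move=> _ [B [[Bpsd [Btr Badj]] ->]].
  have := psd_pairing Bpsd Zpsd.
  (* Here B vanishes on [a], so the pairing sees only the multiples of I and J in Z. *)
  have -> : \sum_i \sum_j B i j * Z i j
    = lam - (lam + D) / N * (\sum_i \sum_j B i j).
    rewrite -[X in X - _]mulr1 -Btr !mulr_sumr -sumrB; apply: eq_bigr => i _.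
    rewrite mulr_sumr [X in X - _]mulrC -(sumdiag (fun j => B i j * lam) i).
    rewrite -sumrB; apply: eq_bigr => j _; rewrite /Z.
    by case aij : (a i j); rewrite ?(Badj _ _ aij) /=; ring.
  rewrite subr_ge0 -ler_pdivlMl ?divr_gt0 ?addr_gt0 // => /le_trans; apply.
  rewrite le_eqVlt; apply/orP; left; apply/eqP; field.
  by rewrite !gt_eqF // ?addr_gt0 ?divr_gt0.
Qed.

(** * Harmonic functions *)

(** Functions on i-sets are extended by zero to all subsets, so that sums over S need no size
    restriction. *)
Definition harmonic (R : realFieldType) (T : finType) (i : nat)
    (h : {set T} -> R) : Prop :=
  (forall S : {set T}, #|S| != i -> h S = 0) /\
  (forall S : {set T}, \sum_(x | x \notin S) h (x |: S) = 0).

(** The zeta transform of the subset lattice; read on k-sets, it carries functions on i-sets to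
    functions on k-sets. *)
Definition zeta (R : realFieldType) (T : finType) (h : {set T} -> R)
    (A : {set T}) : R := \sum_(S : {set T} | S \subset A) h S.

Lemma sum_setU1 (R : realFieldType) (T : finType) (x : T)
    (P : pred {set T}) (h : {set T} -> R) :
  \sum_(S : {set T} | P S && (x \notin S)) h (x |: S)
    = \sum_(S : {set T} | P (S :\ x) && (x \in S)) h S.
Proof.
symmetry; rewrite (reindex_onto (fun S => x |: S) (fun S => S :\ x)) /=.
  apply: eq_bigl => S; rewrite setU11 andbT.
  have [xS|xS] := boolP (x \in S).
    rewrite andbF; apply/negbTE; apply: contraL xS => /andP[_ /eqP <-].
    by rewrite !inE eqxx.
  by rewrite setU1K // eqxx.
by move=> S /andP[_ xS]; rewrite setD1K.
Qed.

Lemma card_setD1D (T : finType) (x : T) (S A : {set T}) (j : nat) : x \in S ->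
  (#|(S :\ x) :\: A| == j) = (#|S :\: A| == (x \notin A) + j)%N.
Proof.
move=> xS; have [xA|xA] /= := boolP (x \in A).
  rewrite (_ : (S :\ x) :\: A = S :\: A) //.
  by apply/setP => y; rewrite !inE; case: eqP => [->|]; rewrite ?xA ?andbF.
rewrite (cardsD1 x (S :\: A)) !inE xA xS eqn_add2l.
by rewrite !setDDl [A :|: _]setUC.
Qed.

(** Let Phi j be the left-hand side. Add up the harmonicity conditions at all S with |S \ A| = j and
    regroup by x |: S: a set at level j + 1 arises j + 1 times, an i-set at level j arises i - j
    times. Hence (j + 1) Phi (j + 1) + (i - j) Phi j = 0, and Phi 0 is [zeta h A]. *)
Lemma harmonic_level_sum (R : realFieldType) (T : finType) (i : nat)
    (h : {set T} -> R) (A : {set T}) (j : nat) : harmonic i h ->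
  \sum_(S : {set T} | #|S :\: A| == j) h S
    = (-1) ^+ j * 'C(i, j)%:R * zeta h A.
Proof.
move=> [hi h0]; elim: j => [|j IHj].
  rewrite bin0 mul1r mul1r; apply: eq_bigl => S.
  by rewrite cards_eq0 setD_eq0.
set Phi := fun j : nat => \sum_(S : {set T} | #|S :\: A| == j) h S.
have rec : j.+1%:R * Phi j.+1 + (i%:R - j%:R) * Phi j = 0.
  rewrite /Phi !mulr_sumr.
  have : \sum_(S : {set T} | #|S :\: A| == j) \sum_(x | x \notin S) h (x |: S) = 0.
    by apply: big1 => S _; apply: h0.
  rewrite (exchange_big_dep xpredT) //=.
  under eq_bigr => x _ do
    rewrite (sum_setU1 x (fun S => #|S :\: A| == j)).
  rewrite (exchange_big_dep xpredT) //= => Dh0; rewrite -[RHS]Dh0.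
  rewrite [X in X + _]big_mkcond /= [X in _ + X]big_mkcond -big_split /=.
  apply: eq_bigr => S _.
  rewrite (eq_bigl (fun x => (x \in S) && (#|S :\: A| == (x \notin A) + j)%N));
    last first.
    by move=> x; rewrite andbC; case xS : (x \in S) => //=; rewrite card_setD1D.
  rewrite (bigID (fun x => x \in A)) /=.
  rewrite (eq_bigl (fun x => (x \in S :&: A) && (#|S :\: A| == j)%N)); last first.
    move=> x; rewrite !inE; case: (x \in A) => //=; rewrite ?andbT ?andbF //.
  rewrite [X in _ = _ + X](eq_bigl
    (fun x => (x \in S :\: A) && (#|S :\: A| == j.+1)%N)); last first.
    move=> x; rewrite !inE; case: (x \in A) => //=; rewrite ?andbT ?andbF //.
  rewrite addrC; congr (_ + _).
    case: eqP => [Sj|_]; last by rewrite big_pred0 // => x; rewrite andbF.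
    under eq_bigl => x do rewrite andbT.
    rewrite sumr_const -[RHS]mulr_natl.
    have [Si|/hi->] := eqVneq #|S| i; last by rewrite !mulr0.
    by rewrite -Si -(cardsID A S) Sj natrD addrK.
  case: eqP => [Sj|_]; last by rewrite big_pred0 // => x; rewrite andbF.
  under eq_bigl => x do rewrite andbT.
  by rewrite sumr_const -[RHS]mulr_natl Sj.
have IHP : Phi j = (-1) ^+ j * 'C(i, j)%:R * zeta h A := IHj.
rewrite -/(Phi j.+1).
apply: (mulfI (x := j.+1%:R)); first by rewrite pnatr_eq0.
move/eqP: rec; rewrite addr_eq0 => /eqP ->; rewrite IHP.
have bE : j.+1%:R * 'C(i, j.+1)%:R = (i%:R - j%:R) * 'C(i, j)%:R :> R.
  rewrite -natrM mul_bin_left natrM; have [ij|ij] := leqP j i.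
    by rewrite natrB.
  by rewrite bin_small // mulr0n !mulr0.
have -> : j.+1%:R * ((-1) ^+ j.+1 * 'C(i, j.+1)%:R * zeta h A)
  = (-1) ^+ j.+1 * (j.+1%:R * 'C(i, j.+1)%:R) * zeta h A by ring.
by rewrite bE exprS; ring.
Qed.

(** Any kernel that depends only on |S \ A| thus acts on h as a scalar multiple of [zeta]; both the
    eigenvalues and the orthogonality relations come from this. *)
Lemma harmonic_sum (R : realFieldType) (T : finType) (i : nat)
    (h : {set T} -> R) (A : {set T}) (phi : nat -> R) : harmonic i h ->
  \sum_(S : {set T}) h S * phi #|S :\: A|
    = (\sum_(j < i.+1) (-1) ^+ j * 'C(i, j)%:R * phi j) * zeta h A.
Proof.
move=> hh; transitivity (\sum_(S : {set T} | #|S| == i) h S * phi #|S :\: A|).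
  rewrite [RHS]big_mkcond; apply: eq_bigr => S _.
  by case: eqP => // /eqP /hh.1->; rewrite mul0r.
(* Only i-sets are left, so |S \ A| is at most i and [inord] loses nothing. *)
rewrite (partition_big (fun S : {set T} => inord #|S :\: A| : 'I_i.+1) xpredT) //=.
rewrite mulr_suml; apply: eq_bigr => j _.
rewrite mulrAC -(harmonic_level_sum A j hh) mulr_suml.
rewrite [RHS](bigID (fun S : {set T} => #|S| == i)) /= [X in _ = _ + X]big1.
  rewrite addr0; apply: congr_big => // S.
    rewrite andbC; have [Si|] := eqVneq #|S| i; rewrite ?andbF ?andbT //.
    by rewrite -val_eqE /= inordK // ltnS -Si subset_leq_card ?subsetDl.
  move=> /andP[/eqP Si /eqP <-]; rewrite inordK //.
  by rewrite ltnS -Si subset_leq_card ?subsetDl.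
by move=> S /andP[_ /hh.1->]; rewrite mul0r.
Qed.

(** * Eberlein's binomial identity and counting of k-sets *)

Lemma coef_1DX_exp (R : comNzRingType) (n d : nat) :
  ((1 + 'X) ^+ n : {poly R})`_d = 'C(n, d)%:R.
Proof.
elim: n d => [|n IHn] d; first by rewrite expr0 coef1; case: d.
rewrite exprS mulrDl mul1r coefD IHn coefXM.
by case: d => [|d]; rewrite /= ?bin0 ?addr0 // IHn binS natrD addrC.
Qed.

(** The product p(x) q(z) is encoded with x as the inner and z as the outer variable. *)
Lemma coef_polyC_mul_map (R : comNzRingType) (p q : {poly R}) (d e : nat) :
  (p%:P * map_poly polyC q)`_e`_d = p`_d * q`_e.
Proof. by rewrite coefCM coef_map coefMC. Qed.

(* Both sides are the coefficient of x^d z^(m+i-d) in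
   (1 + x)^c (1 + z)^m ((1 + z) - (1 + x))^i. *)
Lemma eberlein_binomial (R : comNzRingType) (i c m d : nat) : (d <= m)%N ->
  \sum_(j < i.+1) (-1) ^+ j * 'C(i, j)%:R
      * ('C(c + j, d) * 'C(m + i - j, m + i - d))%:R
  = \sum_(j < d.+1) (-1) ^+ j * 'C(i, j)%:R * 'C(c, d - j)%:R * 'C(m, d - j)%:R
    :> R.
Proof.
move=> dm; pose e := (m + i - d)%N.
pose F (p q : {poly R}) : {poly {poly R}} := p%:P * map_poly polyC q.
pose x : {poly R} := 'X.
have FM p q p' q' : F p q * F p' q' = F (p * p') (q * q').
  by rewrite /F polyCM rmorphM /=; ring.
have FX p q r : F p q ^+ r = F (p ^+ r) (q ^+ r).
  by rewrite /F exprMn !rmorphXn.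
have Fcoef p q s : (F p q *+ s)`_e`_d = s%:R * (p`_d * q`_e).
  by rewrite !coefMn coef_polyC_mul_map mulr_natl.
have sgn j (P : {poly {poly R}}) : ((-1) ^+ j * P)`_e`_d = (-1) ^+ j * P`_e`_d.
  by rewrite -signr_odd -[in RHS]signr_odd; case: (odd j);
     rewrite ?expr1 ?mulN1r ?coefN ?expr0 ?mul1r.
(* The last factor is (1 + z) - (1 + x) on the left and z - x on the right; expanding its i-th power
   in each form gives the two sums. *)
have key : F ((1 + x) ^+ c) ((1 + x) ^+ m) * (F 1 (1 + x) - F (1 + x) 1) ^+ i
    = F ((1 + x) ^+ c) ((1 + x) ^+ m) * (F 1 x - F x 1) ^+ i.
  congr (_ * _ ^+ i); rewrite /F !rmorphD !rmorph1 /=; ring.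
move: (congr1 (fun P : {poly {poly R}} => P`_e`_d) key).
rewrite !exprBn !mulr_sumr !coef_sum.
have side (f g : {poly R}) j : (F ((1 + x) ^+ c) ((1 + x) ^+ m) *
    ((-1) ^+ j * F 1 g ^+ (i - j) * F f 1 ^+ j *+ 'C(i, j)))`_e`_d
  = (-1) ^+ j * 'C(i, j)%:R
    * (((1 + x) ^+ c * f ^+ j)`_d * ((1 + x) ^+ m * g ^+ (i - j))`_e).
  have ACE (a b s t : {poly {poly R}}) : a * (s * b * t) = s * (a * (t * b)).
    by ring.
  rewrite [in LHS]mulrnAr ACE !FX !expr1n !FM mul1r mulr1 -mulrnAr sgn Fcoef.
  exact: mulrA.
under eq_bigr => j _ do rewrite side -exprD -exprD !coef_1DX_exp.
under [in RHS]eq_bigr => j _ do rewrite side !coefMXn !coef_1DX_exp.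
move=> H; transitivity (\sum_(j < i.+1) (-1) ^+ j * 'C(i, j)%:R
   * ('C(c + j, d)%:R * 'C(m + (i - j), e)%:R) : R).
  by apply: eq_bigr => j _; rewrite natrM addnBA // -ltnS.
rewrite {}H; pose G j : R := (-1) ^+ j * 'C(i, j)%:R * 'C(c, d - j)%:R * 'C(m, d - j)%:R.
(* The expansion stops at i and the target at d. Terms beyond d lack x^d, and terms beyond i have a
   zero binomial. *)
transitivity (\sum_(0 <= j < (minn i d).+1) G j).
  rewrite big_mkord (big_ord_widen i.+1 G) ?ltnS ?geq_minl //.
  rewrite [RHS]big_mkcond; apply: eq_bigr => j _.
  have ji : (j <= i)%N by rewrite -ltnS.
  rewrite ltnS leq_min ji /=; case: ltnP => dj.
    by rewrite mul0r mulr0.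
  rewrite (_ : (e < i - j)%N = false); last by apply/negbTE; rewrite -leqNgt /e; lia.
  rewrite /G mulrA -[X in _ = _ * X%:R]bin_sub; last by lia.
  by congr (_ * _ * 'C(_, _)%:R); rewrite /e; lia.
rewrite big_mkord (big_ord_widen d.+1 G) ?ltnS ?geq_minr //.
rewrite big_mkcond; apply: eq_bigr => j _.
have jd : (j <= d)%N by rewrite -ltnS.
rewrite ltnS leq_min jd andbT; case: leqP => // ij.
by rewrite bin_small // mulr0 !mul0r.
Qed.

(** C is determined by C :&: A and C :\: A, which are chosen independently. *)
Lemma card_draws_split (T : finType) (X A : {set T}) (p q : nat) :
  #|[set C : {set T} | [&& C \subset X, #|C :&: A| == p & #|C :\: A| == q]]|
    = ('C(#|X :&: A|, p) * 'C(#|X :\: A|, q))%N.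
Proof.
rewrite -!cards_draws -cardsX.
set P := [set C : {set T} | C \subset X :&: A & _].
set Q := [set C : {set T} | C \subset X :\: A & _].
have PA C : C \in P -> C :&: A = C.
  by rewrite inE subsetI => /andP[/andP[_ /setIidPl]].
have PD C : C \in P -> C :\: A = set0.
  by rewrite inE subsetI => /andP[/andP[_ CA] _]; apply/eqP; rewrite setD_eq0.
have QD C : C \in Q -> C :\: A = C.
  rewrite inE subsetD => /andP[/andP[_ CA] _]; apply/setDidPl; exact: CA.
have QA C : C \in Q -> C :&: A = set0.
  by rewrite inE subsetD => /andP[/andP[_ CA] _]; apply: disjoint_setI0.
have split a b : a \in P -> b \in Q -> (a :|: b) :&: A = a /\ (a :|: b) :\: A = b.
  move=> aP bQ; rewrite setIUl setDUl PA // QA // PD // QD //.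
  by rewrite setU0 set0U.
rewrite -(card_in_imset (f := fun u : {set T} * {set T} => u.1 :|: u.2)); last first.
  move=> [a b] [a' b'] /setXP[/= aP bQ] /setXP[/= aP' bQ'] /= E.
  have [Ea Eb] := split _ _ aP bQ; have [Ea' Eb'] := split _ _ aP' bQ'.
  by congr (_, _); [rewrite -Ea E Ea' | rewrite -Eb E Eb'].
apply: eq_card => C; apply/idP/imsetP => [|[[a b] /setXP[/= aP bQ] ->]].
  rewrite inE => /and3P[CX Cp Cq]; exists (C :&: A, C :\: A); last by rewrite /= setID.
  by rewrite inE /= !inE Cp Cq !andbT setSI // setSD.
have [Ea Eb] := split _ _ aP bQ; rewrite inE Ea Eb subUset.
move: aP bQ; rewrite !inE subsetI subsetD.
by move=> /andP[/andP[-> _] ->] /andP[/andP[-> _] ->].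
Qed.

(** Passing to the complement of B turns S \subset B into avoidance of S, which leaves two
    independent draws, inside and outside A. *)
Lemma card_kset_inter (T : finType) (A S : {set T}) (l : nat) :
  (l <= #|A|)%N -> (#|A| + (#|A| - l) <= #|T|)%N ->
  #|[set B : {set T} | [&& S \subset B, #|B| == #|A| & #|A :&: B| == l]]|
    = ('C(#|A :\: S|, #|A| - l) * 'C(#|~: (A :|: S)|, #|T| - #|A| - (#|A| - l)))%N.
Proof.
move=> lA AT; rewrite (_ : A :\: S = (~: S) :&: A); last first.
  by rewrite setDE setIC.
rewrite (_ : ~: (A :|: S) = (~: S) :\: A); last first.
  by rewrite setDE setCU setIC.
rewrite -card_draws_split -(card_imset _ (@setC_inj T)).
apply: eq_card => B; rewrite -[B]setCK (mem_imset _ _ (@setC_inj T)).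
move: (~: B) => C {B}; rewrite !inE [~: C \subset _]subsetC !setCK; congr (_ && _).
have := cardsC C; have := cardsID A (~: C); have := cardsID C A.
have := subset_leq_card (subsetIl A C).
by rewrite [~: C :&: A]setIC -setDE => ? ? ? ?; lia.
Qed.

(** * Decomposition into harmonic components *)

(** Orthogonal projection onto the span of a possibly dependent family, by Gram-Schmidt. *)
Lemma orthogonal_decomposition (R : realFieldType) (I V : finType)
    (u : I -> V -> R) (f : V -> R) :
  exists c : I -> R,
    forall i, \sum_x (f x - \sum_j c j * u j x) * u i x = 0.
Proof.
(* The induction is for all f at once, since it is applied to f and to the new vector [u a]; both
   expansions must use indices of s only. *)
suff H (s : seq I) : uniq s -> forall f, exists c : I -> R,
    (forall j, j \notin s -> c j = 0) /\
    (forall i, i \in s -> \sum_x (f x - \sum_j c j * u j x) * u i x = 0).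
  have [c [_ cP]] := H (enum I) (enum_uniq I) f.
  by exists c => i; apply: cP; rewrite mem_enum.
elim: s => [|a s IHs] /=; first by move=> _ {}f; exists (fun=> 0).
move=> /andP[as_ us] {}f.
have [c1 [c1s c1P]] := IHs us f; have [c2 [c2s c2P]] := IHs us (u a).
set g := fun x => f x - \sum_j c1 j * u j x.
set w := fun x => u a x - \sum_j c2 j * u j x.
(* If w = 0 the quotient defaults to 0, which is harmless: [u a] is then already in the span of the
   earlier vectors. *)
set t := (\sum_x g x * w x) / (\sum_x w x * w x).
pose c j := c1 j + t * ((j == a)%:R - c2 j).
have cE x : f x - \sum_j c j * u j x = g x - t * w x.
  rewrite /g /w; have -> : u a x = \sum_j (j == a)%:R * u j x.
    rewrite (bigD1 a) //= eqxx mul1r big1 ?addr0 // => j /negPf->.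
    by rewrite mul0r.
  rewrite -sumrB mulr_sumr -addrA -opprD -big_split /=.
  by congr (_ - _); apply: eq_bigr => j _; rewrite /c; ring.
have cs i : i \in s -> \sum_x (g x - t * w x) * u i x = 0.
  move=> si; have -> : \sum_x (g x - t * w x) * u i x
      = \sum_x g x * u i x - t * \sum_x w x * u i x.
    by rewrite mulr_sumr -sumrB; apply: eq_bigr => x _; ring.
  by rewrite c1P // c2P // mulr0 subrr.
have cw : \sum_x (g x - t * w x) * w x = 0.
  have -> : \sum_x (g x - t * w x) * w x
      = \sum_x g x * w x - t * \sum_x w x * w x.
    by rewrite mulr_sumr -sumrB; apply: eq_bigr => x _; ring.
  rewrite /t; have [ww0|ww0] := eqVneq (\sum_x w x * w x) 0; last first.
    by rewrite divfK ?subrr.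
  rewrite ww0 mulr0 subr0; apply: big1 => x _.
  have /eqP := ww0; rewrite psumr_eq0 => [/allP/(_ x)|y _]; last first.
    by rewrite -expr2 sqr_ge0.
  rewrite mem_index_enum => /(_ isT) /=; rewrite mulf_eq0 orbb => /eqP->.
  by rewrite mulr0.
exists c; split=> [j|i].
  rewrite inE negb_or => /andP[/negPf ja js].
  by rewrite /c ja c1s // c2s // subr0 mulr0 addr0.
under eq_bigr => x _ do rewrite cE.
rewrite inE => /orP[/eqP->|]; last exact: cs.
have uE x : u a x = w x + \sum_j c2 j * u j x by rewrite /w subrK.
under eq_bigr => x _ do rewrite uE mulrDr mulr_sumr.
rewrite big_split /= cw add0r exchange_big /= big1 // => j _.
have [js|/c2s c2j] := boolP (j \in s).
  transitivity (c2 j * \sum_x (g x - t * w x) * u j x).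
    by rewrite mulr_sumr; apply: eq_bigr => x _; ring.
  by rewrite cs // mulr0.
by rewrite c2j big1 // => x _; rewrite mul0r mulr0.
Qed.

Lemma zeta_linear (R : realFieldType) (T : finType) (a : R)
    (f g : {set T} -> R) (B : {set T}) :
  zeta (fun S => f S + a * g S) B = zeta f B + a * zeta g B.
Proof. by rewrite /zeta mulr_sumr -big_split. Qed.

Lemma harmonic0 (R : realFieldType) (T : finType) (i : nat) :
  harmonic i (fun _ : {set T} => 0 : R).
Proof. by split=> // S; rewrite big1. Qed.

(** Project f onto the span of the indicators u S of the one-point extensions of t-sets S. The
    residue is harmonic, and on k-sets the projection has the same zeta transform as a function on
    t-sets, to which induction applies. *)
Lemma harmonic_decomposition (R : realFieldType) (T : finType) (k t : nat)
    (f : {set T} -> R) : (forall S : {set T}, #|S| != t -> f S = 0) ->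
  exists h : nat -> {set T} -> R, (forall i, harmonic i (h i)) /\
    (forall B : {set T}, #|B| = k -> zeta f B = \sum_(i < t.+1) zeta (h i) B).
Proof.
elim: t f => [|t IHt] f f_supp.
  exists (fun i => if i is 0%N then f else fun=> 0); split=> [[|i]|B _].
  - split=> // S; apply: big1 => x xS; apply: f_supp.
    by rewrite cardsU1 xS.
  - exact: harmonic0.
  - by rewrite big_ord_recl big_ord0 addr0.
pose u (S S' : {set T}) : R :=
  (#|S| == t)%:R * \sum_(x | x \notin S) (S' == x |: S)%:R.
have [c cP] := orthogonal_decomposition u f.
pose g S' := f S' - \sum_S c S * u S S'.
have u_supp (S S' : {set T}) : #|S'| != t.+1 -> u S S' = 0.
  rewrite /u; case: (#|S| =P t) => [St S't|]; last by rewrite mul0r.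
  rewrite big1 ?mulr0 // => x xS; case: eqP => // S'E.
  by move: S't; rewrite S'E cardsU1 xS St eqxx.
have g_harm : harmonic t.+1 g.
  split=> [S St|S].
    by rewrite /g f_supp // big1 ?subrr // => S' _; rewrite u_supp ?mulr0.
  have [St|St] := eqVneq #|S| t; last first.
    apply: big1 => x xS; rewrite /g f_supp ?cardsU1 ?xS //.
    by rewrite big1 ?subrr // => S' _; rewrite u_supp ?mulr0 // cardsU1 xS.
  (* Orthogonality of g to u S is precisely the harmonicity condition at S. *)
  rewrite -[RHS](cP S) /u.
  rewrite [RHS](eq_bigr (fun S' : {set T} =>
    \sum_(x | x \notin S) g S' * (S' == x |: S)%:R));
    last by move=> S' _; rewrite St eqxx mul1r mulr_sumr.
  rewrite exchange_big /=; apply: eq_bigr => x _.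
  rewrite (bigD1 (x |: S)) //= eqxx mulr1 big1 ?addr0 // => S' /negPf->.
  by rewrite mulr0.
(* A t-subset S of a k-set B has k - t one-point extensions inside B. *)
pose f' (S : {set T}) := (k%:R - t%:R) * ((#|S| == t)%:R * c S).
have [h [h_harm hP]] : exists h : nat -> {set T} -> R,
    (forall i, harmonic i (h i)) /\
    (forall B : {set T}, #|B| = k -> zeta f' B = \sum_(i < t.+1) zeta (h i) B).
  by apply: IHt => S /negPf St; rewrite /f' St mul0r mulr0.
exists (fun i => if i == t.+1 then g else h i); split=> [i|B Bk].
  by case: eqP => [->|_].
rewrite big_ord_recr /= eqxx.
under eq_bigr => i _ do rewrite ltn_eqF //.
rewrite -hP // addrC.
have -> : zeta f B = zeta g B + 1 * zeta (fun S' => \sum_S c S * u S S') B.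
  by rewrite -zeta_linear; apply: eq_bigr => S _; rewrite /g mul1r subrK.
rewrite mul1r; congr (_ + _).
rewrite /zeta exchange_big /= [RHS]big_mkcond /=; apply: eq_bigr => S _.
rewrite -mulr_sumr /u /f'; case: eqP => [St|_]; last first.
  rewrite mul0r mulr0 if_same.
  by rewrite big1 ?mulr0 // => S' _; rewrite mul0r.
under eq_bigr => S' _ do rewrite mul1r.
rewrite exchange_big [RHS](_ : _ = c S * ((S \subset B)%:R * (k%:R - t%:R))).
  congr (_ * _).
  have sub1 x : \sum_(S' : {set T} | S' \subset B) (S' == x |: S)%:R
      = ((x |: S) \subset B)%:R :> R.
    have [xSB|xSB] := boolP (_ \subset B).
      rewrite (bigD1 (x |: S)) //= eqxx big1 ?addr0 // => S' /andP[_ /negPf->].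
      by [].
    apply: big1 => S' S'B; case: eqP => // S'E.
    by rewrite -S'E S'B in xSB.
  under eq_bigr => x _ do rewrite sub1.
  have [SB|SB] := boolP (S \subset B); last first.
    rewrite mul0r big1 // => x _; case: (boolP (_ \subset B)) => //.
    by rewrite subUset (negPf SB) andbF.
  rewrite mul1r -natr_sum -natrB -?St -?Bk ?subset_leq_card //.
  congr (_%:R); rewrite -(cardsID S B) (setIidPr SB) addnC addnK.
  rewrite -sum1_card [RHS](eq_bigl (fun x => (x \notin S) && (x \in B))).
    rewrite [RHS]big_mkcondr; apply: eq_bigr => x _.
    by rewrite subUset sub1set SB andbT; case: (x \in B).
  by move=> x; rewrite !inE.
by case: ifP => _ /=; ring.
Qed.

(** * Eigenvalues of the Johnson scheme *)

(* Eigenvalue of the relation |A :&: B| = l on the i-th harmonic component. *)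
Definition eberlein (R : pzRingType) (n k l i : nat) : R :=
  \sum_(j < (k - l).+1) (-1) ^+ j * 'C(i, j)%:R * 'C(k - i, k - l - j)%:R
    * 'C(n - k - i, k - l - j)%:R.

(** After exchanging sums, h S is weighted by the number of k-sets B that contain S and meet A in l
    points. This depends only on |S \ A|, so [harmonic_sum] applies, and [eberlein_binomial] puts
    the scalar in Eberlein's form. *)
Lemma zeta_eigen (R : realFieldType) (T : finType) (k l i : nat)
    (h : {set T} -> R) (A : {set T}) :
  harmonic i h -> (i <= k)%N -> (l <= k)%N -> (k + i + (k - l) <= #|T|)%N ->
  #|A| = k ->
  \sum_(B : {set T} | (#|B| == k) && (#|A :&: B| == l)) zeta h B
    = eberlein R #|T| k l i * zeta h A.
Proof.
move=> hh ik lk nT Ak.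
rewrite /zeta (exchange_big_dep xpredT) //= -/(zeta h A).
have dm : (k - l <= #|T| - k - i)%N by lia.
(* The count for |S \ A| = j, written with m = |T| - k - i to match [eberlein_binomial]. *)
pose phi j : R := ('C(k - i + j, k - l)
  * 'C(#|T| - k - i + i - j, #|T| - k - i + i - (k - l)))%:R.
transitivity (\sum_(S : {set T}) h S * phi #|S :\: A|).
  apply: eq_bigr => S _; have [Si|/hh.1->] := eqVneq #|S| i; last first.
    by rewrite mul0r big1.
  rewrite sumr_const -[LHS]mulr_natr; congr (_ * _%:R).
  have := @card_kset_inter T A S l; rewrite Ak => /(_ lk).
  have kT : (k + (k - l) <= #|T|)%N by lia.
  move=> /(_ kT); rewrite (_ : (#|T| - k - i + i = #|T| - k)%N); last by lia.
  have -> : (#|A :\: S| = k - i + #|S :\: A|)%N.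
    have := cardsID S A; have := cardsID A S.
    by rewrite [A :&: S]setIC Ak Si => ? ?; lia.
  have -> : #|~: (A :|: S)| = (#|T| - k - #|S :\: A|)%N.
    have := cardsC (A :|: S); rewrite cardsU Ak.
    have := cardsID A S; have := subset_leq_card (subsetIl A S).
    by rewrite [A :&: S]setIC Ak Si => ? ? ?; lia.
  move=> <-; rewrite -sum1_card -[RHS]sum1_card; apply: eq_bigl => B.
  by rewrite !inE unfold_in /= andbC.
by rewrite (harmonic_sum _ _ hh) /phi eberlein_binomial.
Qed.

Lemma card_superset (T : finType) (U : {set T}) (k : nat) : (k <= #|T|)%N ->
  #|[set B : {set T} | (#|B| == k) && (U \subset B)]| = 'C(#|T| - #|U|, #|T| - k).
Proof.
move=> kT; have <- : #|~: U| = (#|T| - #|U|)%N by rewrite -(cardsC U) addKn.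
rewrite -cards_draws -(card_imset _ (@setC_inj T)).
apply: eq_card => B; rewrite -[B]setCK (mem_imset _ _ (@setC_inj T)).
rewrite !inE !setCK [B \subset _]subsetC andbC; congr (_ && _).
by have := cardsC B; have := max_card (mem B) => ? ?; lia.
Qed.

(** For fixed S of size i, the number of k-sets containing S :|: S' depends only on |S' \ S|.
    Summing against g gives a multiple of [zeta g S], which is zero because S is too small to
    contain a j-set. *)
Lemma zeta_orthogonal (R : realFieldType) (T : finType) (k i j : nat)
    (h g : {set T} -> R) : (k <= #|T|)%N ->
  harmonic i h -> harmonic j g -> (i < j)%N ->
  \sum_(B : {set T} | #|B| == k) zeta h B * zeta g B = 0.
Proof.
move=> kT hh hg ij; rewrite /zeta.
under eq_bigr => B _ do rewrite mulr_suml.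
rewrite (exchange_big_dep xpredT) //= big1 // => S _.
have [Si|/hh.1->] := eqVneq #|S| i; last by rewrite big1 // => B _; rewrite mul0r.
rewrite -mulr_sumr (exchange_big_dep xpredT) //=.
pose phi m : R := 'C(#|T| - (i + m), #|T| - k)%:R.
transitivity (h S * \sum_(S' : {set T}) g S' * phi #|S' :\: S|).
  congr (_ * _); apply: eq_bigr => S' _; rewrite sumr_const -[LHS]mulr_natr /phi.
  have -> : (i + #|S' :\: S| = #|S :|: S'|)%N.
    have := cardsUI S S'; have := cardsID S S'.
    by rewrite [S :&: S']setIC Si => ? ?; lia.
  rewrite -card_superset //.
  congr (_ * _%:R); rewrite -sum1_card -[RHS]sum1_card; apply: eq_bigl => B.
  by rewrite !inE unfold_in /= subUset andbA.
rewrite (harmonic_sum _ _ hg) /zeta [X in _ * (_ * X)]big1 ?mulr0 // => S' S'S.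
by apply: hg.1; rewrite ltn_eqF // (leq_ltn_trans (subset_leq_card S'S)) ?Si.
Qed.

Lemma sum_kset (V : nmodType) (n k : nat) (F : {set 'I_n} -> V) :
  \sum_(A : kset n k) F (val A) = \sum_(A : {set 'I_n} | #|A| == k) F A.
Proof.
rewrite [RHS](reindex_omap (val : kset n k -> _) insub) /=; last first.
  by move=> A Ak; rewrite insubT.
by apply: eq_bigl => A; rewrite valK eqxx andbT (valP A).
Qed.

Lemma card_kset (n k : nat) : #|{: kset n k}| = 'C(n, k).
Proof.
rewrite card_sig -[in RHS](card_ord n) -card_draws.
by apply: eq_card => A; rewrite !inE.
Qed.

Lemma eberlein0 (R : pzRingType) (n k l : nat) :
  eberlein R n k l 0 = ('C(k, k - l) * 'C(n - k, k - l))%:R.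
Proof.
rewrite /eberlein big_ord_recl big1 => [|j _]; last by rewrite bin0n mulr0 !mul0r.
by rewrite addr0 expr0 bin0 !subn0 !mul1r natrM.
Qed.

(** The component of index 0 is the constants; regularity and zero sums thus become cases of
    [zeta_eigen] and [zeta_orthogonal]. *)
Lemma harmonic_delta0 (R : realFieldType) (T : finType) :
  harmonic 0 (fun S : {set T} => (S == set0)%:R : R).
Proof.
split=> S; first by rewrite cards_eq0 => /negPf->.
by rewrite big1 // => x _; case: eqP => // /setP/(_ x); rewrite !inE eqxx.
Qed.

Lemma zeta_delta0 (R : realFieldType) (T : finType) (A : {set T}) :
  zeta (fun S => (S == set0)%:R : R) A = 1.
Proof.
rewrite /zeta (bigD1 set0) ?sub0set //= eqxx big1 ?addr0 //.
by move=> S /andP[_ /negPf->].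
Qed.

Lemma zeta_sum0 (R : realFieldType) (T : finType) (k i : nat)
    (h : {set T} -> R) : (k <= #|T|)%N -> harmonic i h -> (0 < i)%N ->
  \sum_(B : {set T} | #|B| == k) zeta h B = 0.
Proof.
move=> kT hh i0; rewrite -[RHS](zeta_orthogonal kT (harmonic_delta0 R T) hh i0).
by apply: eq_bigr => B _; rewrite zeta_delta0 mul1r.
Qed.

(** In harmonic components of x the form is a sum of squares weighted by the eigenvalues of the
    matrix. *)
Lemma johnson_psd (R : realType) (n k l : nat) (lam : R) :
  (l <= k)%N -> (k + k + (k - l) <= n)%N ->
  (forall i, (0 < i <= k)%N -> 0 <= lam + eberlein R n k l i) ->
  psd (fun A B : kset n k => lam * (A == B)%:R + (#|val A :&: val B| == l)%:R
    - (lam + eberlein R n k l 0) / 'C(n, k)%:R).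
Proof.
move=> lk nk lam_ge; split=> [A B|x].
  by rewrite eq_sym [val A :&: _]setIC.
have kn : (k <= #|'I_n|)%N by rewrite card_ord; lia.
have N0 : 'C(n, k)%:R != 0 :> R.
  by rewrite pnatr_eq0 -lt0n bin_gt0 -[n]card_ord.
pose f (S : {set 'I_n}) : R := oapp x 0 (insub S : option (kset n k)).
have f_supp (S : {set 'I_n}) : #|S| != k -> f S = 0 by move=> Sk; rewrite /f insubN.
have [h [hh hP]] := harmonic_decomposition k f_supp.
(* The only k-subset of a k-set A is A itself, so [zeta f] agrees with x on k-sets. *)
have xE (A : kset n k) : x A = \sum_(i < k.+1) zeta (h i) (val A).
  have Ak := eqP (valP A); rewrite -hP // /zeta (bigD1 (val A)) //= big1.
    by rewrite addr0 /f valK.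
  move=> S /andP[SA]; rewrite eqEcard SA /= -ltnNge => ltS.
  by apply: f_supp; rewrite ltn_eqF // -Ak.
(* J annihilates the components of positive index, and its coefficient is chosen to cancel lam + D
   on the constants. *)
pose mu i := if i == 0%N then 0 else lam + eberlein R n k l i.
have mu_ge0 i : (i <= k)%N -> 0 <= mu i.
  by rewrite /mu; case: i => [|i] ik //=; apply: lam_ge.
have Zx (A : kset n k) : \sum_B (lam * (A == B)%:R
      + (#|val A :&: val B| == l)%:R - (lam + eberlein R n k l 0) / 'C(n, k)%:R)
      * x B = \sum_(i < k.+1) mu i * zeta (h i) (val A).
  under eq_bigr => B _ do rewrite xE mulr_sumr.
  rewrite exchange_big /=; apply: eq_bigr => i _.
  have ik : (i <= k)%N by rewrite -ltnS.
  transitivity (lam * zeta (h i) (val A) + eberlein R n k l i * zeta (h i) (val A)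
    - (lam + eberlein R n k l 0) / 'C(n, k)%:R
      * \sum_(B : {set 'I_n} | #|B| == k) zeta (h i) B).
    have := @zeta_eigen R 'I_n k l i (h i) (val A); rewrite card_ord => <- //;
      [|by lia|exact/eqP/(valP A)].
    rewrite -[in RHS]sum_kset.
    rewrite big_mkcondr -(sum_kset k (fun B =>
      if #|val A :&: B| == l then zeta (h i) B else 0)) /=.
    have -> : lam * zeta (h i) (val A)
        = \sum_(B : kset n k) lam * (A == B)%:R * zeta (h i) (val B).
      rewrite (bigD1 A) //= eqxx mulr1 big1 ?addr0 // => B.
      by rewrite eq_sym => /negPf->; rewrite mulr0 mul0r.
    rewrite mulr_sumr -big_split -sumrB /=; apply: eq_bigr => B _.
    by case: (#|val A :&: val B| == l) => /=; ring.
  rewrite /mu; case: (posnP i) => [i0|i_gt0]; last first.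
    by rewrite (zeta_sum0 kn (hh i)) // mulr0 subr0 -mulrDl.
  have zc B : zeta (h i) B = h i set0.
    rewrite /zeta (bigD1 set0) ?sub0set //= big1 ?addr0 //.
    by move=> S /andP[_ S0]; apply: (hh i).1; rewrite i0 cards_eq0.
  under eq_bigr => B _ do rewrite zc.
  rewrite zc sumr_const -[_ *+ _]mulr_natl.
  have -> : #|(fun B : {set 'I_n} => #|B| == k)| = 'C(n, k).
    by rewrite -[in RHS](card_ord n) -card_draws; apply: eq_card => B; rewrite inE.
  by rewrite i0 /= mul0r; field.
have -> : \sum_i \sum_j x i * (lam * (i == j)%:R + (#|val i :&: val j| == l)%:R
     - (lam + eberlein R n k l 0) / 'C(n, k)%:R) * x j
  = \sum_(i < k.+1) mu i * \sum_(A : {set 'I_n} | #|A| == k) zeta (h i) A ^+ 2.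
  transitivity (\sum_(A : kset n k) \sum_(i < k.+1)
      mu i * (x A * zeta (h i) (val A))).
    apply: eq_bigr => A _; rewrite (eq_bigr _ (fun _ _ => esym (mulrA _ _ _))).
    rewrite -mulr_sumr Zx mulr_sumr; apply: eq_bigr => i _; exact: mulrCA.
  rewrite exchange_big /=; apply: eq_bigr => i _; rewrite -mulr_sumr.
  congr (_ * _); rewrite -sum_kset.
  under eq_bigr => A _ do rewrite xE mulr_suml.
  rewrite exchange_big /= (bigD1 i) //= [X in _ + X]big1 ?addr0.
    by apply: eq_bigr => A _; rewrite expr2.
  move=> j ji; rewrite (sum_kset k (fun A => zeta (h j) A * zeta (h i) A)).
  case: (ltngtP j i) => [lt_ji|lt_ij|/val_inj ij]; last by rewrite ij eqxx in ji.
    exact: zeta_orthogonal kn (hh j) (hh i) lt_ji.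
  under eq_bigr => A _ do rewrite mulrC.
  exact: zeta_orthogonal kn (hh i) (hh j) lt_ij.
apply: sumr_ge0 => i _; apply: mulr_ge0; first by rewrite mu_ge0 // -ltnS.
by apply: sumr_ge0 => A _; apply: sqr_ge0.
Qed.

(** * Averaging an eigenvector over permutations *)

(** Colour each point by its membership in the two sets. The three cardinalities determine how often
    each of the four colours occurs, so the two colourings differ by a permutation. *)
Lemma perm_set_pair (n : nat) (A B A' B' : {set 'I_n}) :
  #|A| = #|A'| -> #|B| = #|B'| -> #|A :&: B| = #|A' :&: B'| ->
  exists s : {perm 'I_n}, s @: A = A' /\ s @: B = B'.
Proof.
move=> eA eB eAB.
pose c (X Y : {set 'I_n}) := [tuple (x \in X, x \in Y) | x < n].
have cP X Y v : count_mem v (c X Y)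
    = #|(if v.1 then X else ~: X) :&: (if v.2 then Y else ~: Y)|.
  rewrite /= count_map -sum1_count big_enum_cond /= -sum1_card.
  apply: eq_bigl => x; case: v => [[] []]; rewrite !inE /= -pair_eqE /pair_eq /=;
  by case: (x \in X) (x \in Y) => [[]|[]].
have : perm_eq (c A' B') (c A B).
  apply/allP => v _; rewrite /= !cP.
  have := cardsUI A B; have := cardsUI A' B'.
  have := cardsC (A :|: B); have := cardsC (A' :|: B').
  have := cardsID B A; have := cardsID A B; have := cardsID B' A'; have := cardsID A' B'.
  rewrite !setDE !setCU [B :&: A]setIC [B' :&: A']setIC.
  rewrite [B :&: ~: A]setIC [B' :&: ~: A']setIC eA eB eAB.
  move=> HB HA HB' HA' HC HC' HU HU'.
  have UU : #|A' :|: B'| = #|A :|: B| by apply: (@addIn #|A' :&: B'|); rewrite HU HU'.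
  case: v => [[] []] /=; rewrite ?eAB //; apply/eqP.
  - by apply: (@addnI #|A' :&: B'|); rewrite HA HA'.
  - by apply: (@addnI #|A' :&: B'|); rewrite HB HB'.
  - by apply: (@addnI #|A :|: B|); rewrite -{1}UU HC HC'.
(* p carries A' to A and B' to B, hence the inverse. *)
move=> /tuple_permP[p pP]; exists (p^-1)%g.
have pc i : (i \in A', i \in B') = (p i \in A, p i \in B).
  have E : c A' B' = [tuple tnth (c A B) (p i) | i < n] by apply: val_inj.
  by have := congr1 (fun t => tnth t i) E; rewrite !tnth_mktuple.
by split; apply/setP => i; rewrite -[i](permK p) (mem_imset _ _ perm_inj) permK;
   case: (pc i).
Qed.

Lemma card_ord_lt (n m : nat) : (m <= n)%N -> #|[set x : 'I_n | (x < m)%N]| = m.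
Proof.
move=> mn; have w_inj : injective (widen_ord mn) by move=> x y [] /val_inj.
rewrite -[RHS](card_ord m) -[RHS](card_imset _ w_inj).
apply: eq_card => x; rewrite !inE; apply/idP/imsetP => [xm|[y _ ->]] //=.
by exists (Ordinal xm) => //; apply: val_inj.
Qed.

(* The harmonic function is the product of the differences of i pairs of
   coordinates; swapping a pair changes its sign. *)
Lemma exists_harmonic (R : realFieldType) (n i k : nat) :
  (i <= k)%N -> (i + k <= n)%N -> exists h : {set 'I_n} -> R,
    harmonic i h /\ exists2 A : {set 'I_n}, #|A| = k & zeta h A != 0.
Proof.
move=> ik ikn; have iin : (i + i <= n)%N by lia.
pose a (m : 'I_i) : 'I_n := widen_ord iin (lshift i m).
pose b (m : 'I_i) : 'I_n := widen_ord iin (rshift i m).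
have a_inj : injective a by move=> x y [] /val_inj.
have b_inj : injective b by move=> x y /(congr1 val) /= /addnI /val_inj.
have ab x y : (a x == b y) = false.
  by rewrite -val_eqE /=; apply/negbTE/eqP; have := ltn_ord x; lia.
pose p (S : {set 'I_n}) : R := \prod_(m < i) ((a m \in S)%:R - (b m \in S)%:R).
pose h (S : {set 'I_n}) : R := (#|S| == i)%:R * p S.
exists h; split; [split=> [S /negPf Si|S]|].
- by rewrite /h Si mul0r.
- have [iS|Si] := leqP i #|S|.
    apply: big1 => x xS; rewrite /h cardsU1 xS gtn_eqF ?mul0r //.
  (* With fewer than i points, S misses some pair entirely. *)
  have [m [am bm]] : exists m, a m \notin S /\ b m \notin S.
    have [m /andP[am bm]|no] := pickP (fun m => (a m \notin S) && (b m \notin S)).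
      by exists m.
    pose f m := if a m \in S then a m else b m.
    have f_inj : injective f.
      move=> x y; rewrite /f; case: ifP => _; case: ifP => _.
      + exact: a_inj.
      + by move/eqP; rewrite ab.
      + by move/esym/eqP; rewrite ab.
      + exact: b_inj.
    have : (#|f @: [set: 'I_i]| <= #|S|)%N.
      apply/subset_leq_card/subsetP => _ /imsetP[x _ ->]; rewrite /f.
      by case: ifP => // aS; have := no x; rewrite aS => /negbFE.
    by rewrite card_imset // cardsT card_ord leqNgt Si.
  (* Swapping this pair fixes S and reverses the sign of p, so the sum over x equals its own
     opposite. *)
  pose t := tperm (a m) (b m).
  have tS x : x \in S -> t x = x.
    by move=> xS; rewrite tpermD //; apply: contraTneq xS => <-.
  have tSE x : (t x \in S) = (x \in S).
    apply/idP/idP => [/[dup] xS /tS|xS]; last by rewrite tS.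
    by move=> /perm_inj <-.
  have sgn x : p (t x |: S) = - p (x |: S).
    rewrite /p (bigD1 m) //= [in RHS](bigD1 m) //= -mulNr opprB.
    have inS y : (y \in t x |: S) = (t y \in x |: S).
      by rewrite !inE tSE; congr (_ || _); apply/eqP/eqP => [->|<-]; rewrite tpermK.
    congr (_ * _); first by rewrite !inS tpermL tpermR.
    apply: eq_bigr => m' m'm; rewrite !inS !tpermD // ?ab ?[b _ == a _]eq_sym ?ab //.
      by rewrite (inj_eq b_inj) eq_sym.
    by rewrite (inj_eq a_inj) eq_sym.
  suff : \sum_(x | x \notin S) h (x |: S) = - \sum_(x | x \notin S) h (x |: S).
    by move/eqP; rewrite -addr_eq0 -mulr2n mulrn_eq0 => /eqP.
  rewrite {1}(reindex_inj (@perm_inj _ t)) /=.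
  rewrite (eq_bigl _ _ (fun x => congr1 negb (tSE x))) -sumrN.
  by apply: eq_bigr => x xS; rewrite /h sgn !cardsU1 tSE xS mulrN.
- pose L m := [set x : 'I_n | (x < m)%N].
  (* A is [0, i) together with [2i, i + k): it has k points, every a m and no b m. Among its subsets
     only the set of all a m contributes to [zeta h A]. *)
  pose A := L (i + k)%N :\: (L (i + i)%N :\: L i).
  have aA m : a m \in A.
    by rewrite !inE /=; have := ltn_ord m; lia.
  have bA m : b m \notin A.
    by rewrite !inE /=; have := ltn_ord m; lia.
  exists A.
    rewrite cardsD (setIidPr _); last first.
      by apply/subsetP => x; rewrite !inE; lia.
    rewrite cardsD (setIidPr _); last first.
      by apply/subsetP => x; rewrite !inE; lia.
    by rewrite !card_ord_lt; lia.
  pose S0 := a @: [set: 'I_i].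
  have S0i : #|S0| = i by rewrite card_imset // cardsT card_ord.
  have aS0 m : a m \in S0 by apply: imset_f.
  have S0A : S0 \subset A by apply/subsetP => _ /imsetP[m _ ->].
  have pE (S : {set 'I_n}) : S \subset A -> p S = \prod_(m < i) (a m \in S)%:R.
    move=> /subsetP SA; apply: eq_bigr => m _.
    have /negPf -> : b m \notin S by apply: contra (bA m) => /SA.
    by rewrite subr0.
  rewrite /zeta (bigD1 S0) //= big1 => [|S /andP[SA SS0]].
    rewrite addr0 /h S0i eqxx mul1r pE // big1 ?oner_eq0 // => m _.
    by rewrite aS0.
  rewrite /h pE //; case: eqP => [Si|_]; last by rewrite mul0r.
  have [m am|all_a] := pickP (fun m => a m \notin S).
    by rewrite (bigD1 m) //= (negPf am) mul0r mulr0.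
  case/eqP: SS0; apply/esym/eqP; rewrite eqEcard Si S0i leqnn andbT.
  by apply/subsetP => _ /imsetP[m _ ->]; apply: negbFE (all_a m).
Qed.

Lemma johnson_regular (R : realFieldType) (n k l : nat) (A : {set 'I_n}) :
  (l <= k)%N -> (k + (k - l) <= n)%N -> #|A| = k ->
  \sum_(B : {set 'I_n} | (#|B| == k) && (#|A :&: B| == l)) 1 = eberlein R n k l 0.
Proof.
move=> lk kn Ak; have := @zeta_eigen R 'I_n k l 0 _ A (harmonic_delta0 _ _).
rewrite card_ord zeta_delta0 mulr1 addn0 => <- //.
by apply: eq_bigr => B _; rewrite zeta_delta0.
Qed.

(** The averaged matrix W depends only on |A :&: B|, so its entries on the diagonal and on the
    relation l follow from its sums over these classes. Its total vanishes because v sums to zero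
    over the k-sets. *)
Lemma johnson_gram (R : realType) (n k l : nat) :
  (l < k)%N -> (k + k + k <= n)%N -> 0 < eberlein R n k l 0 ->
  exists E : kset n k -> kset n k -> R,
    [/\ psd E, forall A, E A A = 1,
        forall A B, #|val A :&: val B| == l ->
          E A B = eberlein R n k l l.+1 / eberlein R n k l 0
      & \sum_A \sum_B E A B = 0].
Proof.
move=> lk nk D0; set D := eberlein R n k l 0 in D0 *.
have kn : (k <= #|'I_n|)%N by rewrite card_ord; lia.
have [|h [hh [A0 A0k hA0]]] := @exists_harmonic R n l.+1 k lk; first by lia.
pose v (A : {set 'I_n}) := zeta h A.
pose q := \sum_(A : {set 'I_n} | #|A| == k) v A ^+ 2.
have q0 : 0 < q.
  rewrite /q (bigD1 A0) ?A0k //=; apply: ltr_wpDr.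
    by apply: sumr_ge0 => A _; apply: sqr_ge0.
  by rewrite lt_def sqr_ge0 sqrf_eq0 hA0.
pose W (A B : {set 'I_n}) := \sum_(s : {perm 'I_n}) v (s @: A) * v (s @: B).
have W_inv (s : {perm 'I_n}) (A B : {set 'I_n}) : W (s @: A) (s @: B) = W A B.
  rewrite /W [RHS](reindex_inj (mulgI s)) /=; apply: eq_bigr => t _.
  by rewrite -!imset_comp; congr (v _ * v _); apply: eq_imset => x; rewrite /= permM.
have W_orbit (A B A' B' : {set 'I_n}) : #|A| = #|A'| -> #|B| = #|B'| ->
    #|A :&: B| = #|A' :&: B'| -> W A' B' = W A B.
  by move=> eA eB /(perm_set_pair eA eB)[s [<- <-]].
pose M : R := #|{perm 'I_n}|%:R.
have M0 : 0 < M by rewrite ltr0n; apply/card_gt0P; exists 1%g.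
have sum_perm (s : {perm 'I_n}) (F : {set 'I_n} -> R) :
    \sum_(A : {set 'I_n} | #|A| == k) F (s @: A) = \sum_(A : {set 'I_n} | #|A| == k) F A.
  rewrite [RHS](reindex_inj (imset_inj (@perm_inj _ s))) /=.
  by apply: eq_bigl => A; rewrite card_imset //; apply: perm_inj.
pose N : R := 'C(n, k)%:R.
have kN : #|(fun A : {set 'I_n} => #|A| == k)| = 'C(n, k).
  by rewrite -[in RHS](card_ord n) -card_draws; apply: eq_card => A; rewrite inE.
have N0 : 0 < N by rewrite ltr0n bin_gt0 -[n]card_ord.
(* The N equal diagonal entries add up to q for each permutation. *)
have Wdiag (A : {set 'I_n}) : #|A| = k -> N * W A A = M * q.
  move=> Ak; transitivity (\sum_(B : {set 'I_n} | #|B| == k) W B B).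
    transitivity (\sum_(B : {set 'I_n} | #|B| == k) W A A).
      by rewrite sumr_const kN mulr_natl.
    by apply: eq_bigr => B /eqP Bk; apply: W_orbit; rewrite ?setIid ?Ak ?Bk.
  rewrite exchange_big /= (eq_bigr (fun=> q)); first by rewrite sumr_const -mulr_natl.
  move=> s _; rewrite /q -(sum_perm s (fun A => v A ^+ 2)); apply: eq_bigr => B _.
  by rewrite expr2.
(* W is constant on the N * D ordered pairs of the relation; for each permuted v the eigenvector
   equation evaluates the sum. *)
have Wl (A B : {set 'I_n}) : #|A| = k -> #|B| = k -> #|A :&: B| = l ->
    N * D * W A B = M * (eberlein R n k l l.+1 * q).
  move=> Ak Bk ABl.
  transitivity (\sum_(A' : {set 'I_n} | #|A'| == k)
     \sum_(B' : {set 'I_n} | (#|B'| == k) && (#|A' :&: B'| == l)) W A' B').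
    transitivity (\sum_(A' : {set 'I_n} | #|A'| == k) D * W A B).
      by rewrite sumr_const kN -mulr_natl mulrA.
    apply: eq_bigr => A' /eqP A'k; rewrite /D -(@johnson_regular R n k l A') //;
      [|by lia..].
    rewrite mulr_suml; apply: eq_bigr => B' /andP[/eqP B'k /eqP A'B'l].
    by rewrite mul1r; apply: W_orbit; congruence.
  under eq_bigr => A' _ do rewrite exchange_big /=.
  rewrite exchange_big /= (eq_bigr (fun=> eberlein R n k l l.+1 * q)).
    by rewrite sumr_const -mulr_natl.
  move=> s _; have s_inj := @perm_inj _ s.
  rewrite /q -(sum_perm s (fun A => v A ^+ 2)) mulr_sumr.
  apply: eq_bigr => A' /eqP A'k.
  rewrite -mulr_sumr expr2 mulrCA; congr (_ * _).
  have := @zeta_eigen R 'I_n k l l.+1 h (s @: A') hh.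
  rewrite card_ord card_imset // => <- //; [|by lia..].
  rewrite [RHS](reindex_inj (imset_inj s_inj)) /=; apply: eq_bigl => B'.
  by rewrite -imsetI ?card_imset // => x y _ _; apply: s_inj.
clearbody q.
exists (fun A B => N / (M * q) * W (val A) (val B)); split.
- split=> [A B|x].
    by congr (_ * _); apply: eq_bigr => s _; rewrite mulrC.
  have -> : \sum_i \sum_j x i * (N / (M * q) * W (val i) (val j)) * x j
    = N / (M * q) * \sum_(s : {perm 'I_n}) (\sum_i x i * v (s @: val i)) ^+ 2.
    rewrite mulr_sumr (eq_bigr (fun s : {perm 'I_n} => \sum_i \sum_j N / (M * q)
       * ((x i * v (s @: val i)) * (x j * v (s @: val j))))); last first.
      move=> s _; rewrite expr2 mulr_suml mulr_sumr; apply: eq_bigr => i _.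
      by rewrite !mulr_sumr.
    rewrite [RHS]exchange_big /=; apply: eq_bigr => i _.
    rewrite [RHS]exchange_big /=; apply: eq_bigr => j _.
    rewrite /W !mulr_sumr mulr_suml; apply: eq_bigr => s _; ring.
  apply: mulr_ge0; first by rewrite divr_ge0 ?mulr_ge0 ?ltW.
  by apply: sumr_ge0 => s _; apply: sqr_ge0.
- move=> A; rewrite mulrAC Wdiag ?divff //; last exact/eqP/(valP A).
  by rewrite mulf_neq0 ?gt_eqF.
- move=> A B /eqP ABl.
  have := Wl _ _ (eqP (valP A)) (eqP (valP B)) ABl.
  move=> H; apply: (mulfI (x := D)); first by rewrite gt_eqF.
  rewrite [RHS]mulrCA divff ?gt_eqF // mulr1.
  have -> : D * (N / (M * q) * W (val A) (val B)) = (N * D * W (val A) (val B)) / (M * q).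
    by ring.
  by rewrite H; field; rewrite !gt_eqF.
- transitivity (N / (M * q) * \sum_(s : {perm 'I_n})
    (\sum_(A : {set 'I_n} | #|A| == k) v (s @: A))
    * (\sum_(A : {set 'I_n} | #|A| == k) v (s @: A))).
    rewrite mulr_sumr (eq_bigr (fun s : {perm 'I_n} => \sum_(A : kset n k) \sum_(B : kset n k)
       N / (M * q) * (v (s @: val A) * v (s @: val B)))); last first.
      move=> s _; rewrite -!sum_kset mulr_suml mulr_sumr.
      by apply: eq_bigr => A _; rewrite !mulr_sumr.
    rewrite [RHS]exchange_big /=; apply: eq_bigr => A _.
    rewrite [RHS]exchange_big /=; apply: eq_bigr => B _.
    by rewrite /W mulr_sumr.
  rewrite big1 ?mulr0 // => s _.
  by rewrite sum_perm (zeta_sum0 kn hh) // mul0r.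
Qed.

(** * Theta numbers in terms of the eigenvalues *)

Lemma theta_johnson_value (R : realType) (n k l : nat) :
  (l < k)%N -> (k + k + k <= n)%N ->
  (forall i, (i <= k)%N -> eberlein R n k l l.+1 <= eberlein R n k l i) ->
  eberlein R n k l l.+1 < 0 ->
  theta_johnson R n k (pred1 l)
    = 1 + eberlein R n k l 0 / - eberlein R n k l l.+1 /\
  theta_johnson R n k (fun m => (m < k)%N && (m != l))
    = 'C(n, k)%:R / (1 + eberlein R n k l 0 / - eberlein R n k l l.+1).
Proof.
move=> lk nk ev_min ev_lt0.
have D0 : 0 < eberlein R n k l 0.
  by rewrite eberlein0 ltr0n muln_gt0 !bin_gt0; apply/andP; split; lia.
have [E [Epsd Ediag El Esum]] := johnson_gram lk nk D0.
pose a : rel (kset n k) := fun A B => #|val A :&: val B| == l.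
have airr : irreflexive a.
  by move=> A; rewrite /a setIid (eqP (valP A)) gtn_eqF.
have := @lovasz_theta_pair R (kset n k) a (eberlein R n k l 0)
  (- eberlein R n k l l.+1) E.
rewrite card_kset; case.
- by rewrite ltr0n bin_gt0; lia.
- by [].
- by rewrite oppr_gt0.
- by move=> A B; rewrite /a setIC.
- exact: airr.
- move=> A; rewrite (sum_kset k (fun B => (#|val A :&: B| == l)%:R)).
  rewrite -(@johnson_regular R n k l (val A)); [|by lia..|exact/eqP/(valP A)].
  by rewrite [RHS]big_mkcondr; apply: eq_bigr => B _; case: ifP.
- apply: johnson_psd; [by lia..|].
  by move=> i /andP[_ ik]; rewrite addrC subr_ge0 ev_min.
- exact: Epsd.
- exact: Ediag.
- by move=> A B /El ->; rewrite opprK.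
- exact: Esum.
move=> <- <-; split; congr (lovasz_theta _); apply/funext => A; apply/funext => B //.
rewrite /johnson_adj /a /=; have [<-|AB] /= := eqVneq A B.
  by rewrite (airr A : _ == _ = false).
(* Distinct k-sets meet in fewer than k points, so adjacency for the complementary set of sizes is
   just |A :&: B| = l. *)
rewrite negb_and negbK -leqNgt; case: leqP => // kAB.
have : val A = val B.
  have Ak := eqP (valP A); have Bk := eqP (valP B).
  have AI : val A :&: val B = val A.
    by apply/eqP; rewrite eqEcard subsetIl Ak.
  have BI : val A :&: val B = val B.
    by apply/eqP; rewrite eqEcard subsetIr Bk.
  by rewrite -AI BI.
by move/val_inj => E'; rewrite E' eqxx in AB.
Qed.

(** * Asymptotics in n *)

(** This says r n = c + O(1/n). The rate is needed: multiplied back by n or n^(k-1), it yields the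
    error terms of the theorem. *)
Definition limit_O1n (R : realType) (r : nat -> R) (c : R) : Prop :=
  exists (C : R) (N : nat), forall n, (N <= n)%N -> `|r n - c| * n%:R <= C.

Lemma limit_eventually (R : realType) (r s : nat -> R) (c : R) (N : nat) :
  (forall n, (N <= n)%N -> r n = s n) -> limit_O1n r c -> limit_O1n s c.
Proof.
move=> rs [C [N' H]]; exists C, (maxn N N') => n; rewrite geq_max => /andP[Nn N'n].
by rewrite -rs // H.
Qed.

Lemma limit_const (R : realType) (c : R) : limit_O1n (fun=> c) c.
Proof. by exists 0, 0%N => n _; rewrite subrr normr0 mul0r. Qed.

Lemma limitD (R : realType) (r s : nat -> R) (c d : R) :
  limit_O1n r c -> limit_O1n s d -> limit_O1n (fun n => r n + s n) (c + d).
Proof.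
move=> [C [N H]] [C' [N' H']]; exists (C + C'), (maxn N N') => n.
rewrite geq_max => /andP[/H Hn /H' Hn'].
apply: le_trans (lerD Hn Hn'); rewrite -mulrDl ler_wpM2r //.
by rewrite (_ : _ + _ - _ = (r n - c) + (s n - d)) ?ler_normD //; ring.
Qed.

Lemma limitM (R : realType) (r s : nat -> R) (c d : R) :
  limit_O1n r c -> limit_O1n s d -> limit_O1n (fun n => r n * s n) (c * d).
Proof.
move=> [C [N H]] [C' [N' H']].
exists (C * (C' + `|d|) + `|c| * C'), (maxn 1 (maxn N N')) => n.
rewrite !geq_max => /and3P[n1 /H Hn /H' Hn'].
have n1R : 1 <= n%:R :> R by rewrite ler1n.
have s_le : `|s n| <= C' + `|d|.
  rewrite -[s n](subrK d); apply: le_trans (ler_normD _ _) _; rewrite lerD2r.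
  by apply: le_trans Hn'; rewrite ler_peMr.
have -> : r n * s n - c * d = (r n - c) * s n + c * (s n - d) by ring.
apply: le_trans (_ : (`|r n - c| * `|s n| + `|c| * `|s n - d|) * n%:R <= _).
  by rewrite ler_wpM2r // -!normrM ler_normD.
rewrite mulrDl lerD // -mulrA ?ler_wpM2l //.
by rewrite mulrCA [X in X <= _]mulrC [C * _]mulrC; rewrite mulrC ler_pM // mulr_ge0.
Qed.

Lemma limitV (R : realType) (r : nat -> R) (c : R) :
  c != 0 -> limit_O1n r c -> limit_O1n (fun n => (r n)^-1) c^-1.
Proof.
move=> c0 [C [N H]]; have c_gt0 : 0 < `|c| by rewrite normr_gt0.
(* The Archimedean bound makes n at least 2|C|/|c|, which keeps r n within |c|/2 of c and so away
   from 0. *)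
exists (C / (`|c| / 2 * `|c|)), (maxn 1 (maxn N (Num.bound (`|C| / (`|c| / 2))))) => n.
rewrite !geq_max => /and3P[n1 /H Hn nC].
have n_gt0 : 0 < n%:R :> R by rewrite ltr0n.
have rc : `|r n - c| <= `|c| / 2.
  rewrite -(ler_pM2r n_gt0); apply: le_trans Hn _.
  apply: le_trans (ler_norm C) _; rewrite -ler_pdivrMl ?divr_gt0 // mulrC.
  apply: le_trans (_ : (Num.bound (`|C| / (`|c| / 2)))%:R <= _).
    by apply/ltW/archi_boundP; rewrite divr_ge0 // divr_ge0.
  by rewrite ler_nat.
have r_ge : `|c| / 2 <= `|r n|.
  have := ler_normB (r n) (r n - c); rewrite opprB addrC subrK.
  by lra.
have r0 : r n != 0 by rewrite -normr_gt0; lra.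
have -> : (r n)^-1 - c^-1 = - (r n - c) / (r n * c).
  by field; rewrite c0 r0.
rewrite normrM normrN normfV normrM mulrAC.
have den : 0 < `|c| / 2 * `|c| by rewrite mulr_gt0 // divr_gt0.
apply: ler_pM => //; first by rewrite mulr_ge0.
  by rewrite invr_ge0 mulr_ge0.
rewrite lef_pV2 ?posrE //; last by rewrite mulr_gt0 ?normr_gt0.
by rewrite ler_pM2r.
Qed.

Lemma limit_sum (R : realType) (m : nat) (F : nat -> nat -> R) (c : nat -> R) :
  (forall j, (j < m)%N -> limit_O1n (F j) (c j)) ->
  limit_O1n (fun n => \sum_(j < m) F j n) (\sum_(j < m) c j).
Proof.
elim: m => [|m IHm] H.
  apply: (limit_eventually (N := 0%N) _ (limit_const _)) => n _.
  by rewrite !big_ord0.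
have HD := limitD (IHm (fun j jm => H j (leqW jm))) (H m (leqnn _)).
rewrite big_ord_recr; apply: (limit_eventually (N := 0%N) _ HD) => n _.
by rewrite big_ord_recr.
Qed.

Lemma limit_gt0 (R : realType) (r : nat -> R) (c : R) : 0 < c ->
  limit_O1n r c -> exists N, forall n, (N <= n)%N -> 0 < r n.
Proof.
move=> c0 [C [N H]]; exists (maxn 1 (maxn N (Num.bound (`|C| / c)))) => n.
rewrite !geq_max => /and3P[n1 /H Hn nC].
have n_gt0 : 0 < n%:R :> R by rewrite ltr0n.
have : C < c * n%:R.
  apply: le_lt_trans (ler_norm C) _; rewrite -ltr_pdivrMl // mulrC.
  apply: lt_le_trans (_ : (Num.bound (`|C| / c))%:R <= _).
    by apply/archi_boundP; rewrite divr_ge0 // ltW.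
  by rewrite ler_nat.
move/(le_lt_trans Hn); rewrite ltr_pM2r // => lt_c.
by have := ler_norm (c - r n); rewrite distrC; lra.
Qed.

Lemma limit_lift (R : realType) (u : nat -> R) (c : R) (p m : nat) : (p < m)%N ->
  limit_O1n (fun n => u n / n%:R ^+ p) c -> limit_O1n (fun n => u n / n%:R ^+ m) 0.
Proof.
have step q d : limit_O1n (fun n => u n / n%:R ^+ q) d ->
    limit_O1n (fun n => u n / n%:R ^+ q.+1) 0.
  have inv0 : limit_O1n (fun n => n%:R^-1 : R) 0.
    exists 1, 1%N => n n1; rewrite subr0 normfV normr_nat mulVf // pnatr_eq0.
    by rewrite -lt0n.
  move=> uq; have := limitM uq inv0; rewrite mulr0.
  by apply: (limit_eventually (N := 0%N)) => n _; rewrite -mulrA -invfM -exprSr.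
move=> /subnK <- up; elim: (m - p.+1)%N => [|q IHq]; first exact: step up.
exact: step IHq.
Qed.

Lemma limit_binomial (R : realType) (a p : nat) :
  limit_O1n (fun n => 'C(n - a, p)%:R / n%:R ^+ p : R) (p`!%:R)^-1.
Proof.
elim: p => [|p IHp].
  apply: (limit_eventually (N := 0%N) _ (limit_const _)) => n _.
  by rewrite bin0 fact0 expr0 divr1 invr1.
have lin : limit_O1n (fun n => (n - a - p)%:R / n%:R : R) 1.
  exists (a + p)%:R, (a + p).+1 => n apn.
  have n0 : n%:R != 0 :> R by rewrite pnatr_eq0; lia.
  rewrite -subnDA natrB; last by lia.
  rewrite mulrBl divff // addrAC subrr add0r normrN normrM normfV !normr_nat.
  by rewrite divfK.
have := limitM (limitM lin IHp) (limit_const (p.+1%:R^-1 : R)).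
rewrite mul1r factS natrM invfM mulrC; apply: (limit_eventually (N := 1%N)) => n n1.
have n0 : n%:R != 0 :> R by rewrite pnatr_eq0 -lt0n.
have p0 : p.+1%:R != 0 :> R by rewrite pnatr_eq0.
have b : p.+1%:R * 'C(n - a, p.+1)%:R = (n - a - p)%:R * 'C(n - a, p)%:R :> R.
  by rewrite -!natrM mul_bin_left.
apply: (mulfI p0); rewrite [RHS]mulrA b exprS.
by field; rewrite expf_neq0 n0 // addrC natr1 p0.
Qed.

(** Only the term j = 0 reaches degree k - l in n; its coefficient is positive for i <= l. *)
Lemma limit_eberlein_top (R : realType) (k l i : nat) :
  limit_O1n (fun n => eberlein R n k l i / n%:R ^+ (k - l))
    ('C(k - i, k - l)%:R / (k - l)`!%:R).
Proof.
rewrite /eberlein; set d := (k - l)%N.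
pose F j n : R := (-1) ^+ j * 'C(i, j)%:R * 'C(k - i, d - j)%:R
  * 'C(n - k - i, d - j)%:R / n%:R ^+ d.
pose c j : R := (j == 0%N)%:R * ('C(k - i, d)%:R / d`!%:R).
have -> : 'C(k - i, d)%:R / d`!%:R = \sum_(j < d.+1) c j.
  rewrite big_ord_recl big1 ?addr0; first by rewrite /c mul1r.
  by move=> j _; rewrite /c mul0r.
have HF j : (j < d.+1)%N -> limit_O1n (F j) (c j).
  move=> jd; have bin := @limit_binomial R (k + i) (d - j).
  case: j jd bin => [|j] jd bin.
    rewrite [c _]mul1r /F; rewrite subn0 in bin *.
    have := limitM (limit_const ('C(k - i, d)%:R : R)) bin.
    apply: (limit_eventually (N := 0%N)) => n _.
    by rewrite bin0 expr0 !mul1r mulrA subnDA.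
  rewrite /c mul0r.
  have jd' : (d - j.+1 < d)%N by lia.
  have := limitM (limit_const ((-1) ^+ j.+1 * 'C(i, j.+1)%:R * 'C(k - i, d - j.+1)%:R : R))
    (limit_lift jd' bin).
  rewrite mulr0; apply: (limit_eventually (N := 0%N)) => n _.
  by rewrite mulrA subnDA.
apply: (limit_eventually (N := 0%N) _ (limit_sum HF)) => n _.
by rewrite mulr_suml.
Qed.

(** For i > l the term j = 0 vanishes, as 'C(k - i, k - l) = 0, and j = 1 leads. *)
Lemma limit_eberlein_sub (R : realType) (k l i : nat) : (l < i)%N -> (l < k)%N ->
  limit_O1n (fun n => eberlein R n k l i / n%:R ^+ (k - l - 1))
    (- i%:R * 'C(k - i, k - l - 1)%:R / (k - l - 1)`!%:R).
Proof.
move=> li lk; rewrite /eberlein; set d := (k - l)%N.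
pose F j n : R := (-1) ^+ j * 'C(i, j)%:R * 'C(k - i, d - j)%:R
  * 'C(n - k - i, d - j)%:R / n%:R ^+ (d - 1).
set c1 := _ / _; pose c j : R := (j == 1%N)%:R * c1.
have -> : c1 = \sum_(j < d.+1) c j.
  have d1 : (1 < d.+1)%N by rewrite /d; lia.
  rewrite (bigD1 (Ordinal d1)) //= big1 ?addr0; first by rewrite /c mul1r.
  by move=> j; rewrite -val_eqE /c /= => /negPf->; rewrite mul0r.
have HF j : (j < d.+1)%N -> limit_O1n (F j) (c j).
  move=> jd; have bin := @limit_binomial R (k + i) (d - j).
  case: j jd bin => [|[|j]] jd bin.
  - rewrite /c mul0r; apply: (limit_eventually (N := 0%N) _ (limit_const _)) => n _.
    by rewrite /F subn0 (@bin_small (k - i) d) ?mulr0 ?mul0r // /d; lia.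
  - rewrite [c _]mul1r /F /c1.
    have := limitM (limit_const (- i%:R * 'C(k - i, d - 1)%:R : R)) bin.
    apply: (limit_eventually (N := 0%N)) => n _.
    by rewrite bin1 expr1 mulN1r mulrA subnDA.
  rewrite /c mul0r.
  have jd' : (d - j.+2 < d - 1)%N by lia.
  have := limitM (limit_const ((-1) ^+ j.+2 * 'C(i, j.+2)%:R * 'C(k - i, d - j.+2)%:R : R))
    (limit_lift jd' bin).
  rewrite mulr0; apply: (limit_eventually (N := 0%N)) => n _.
  by rewrite mulrA subnDA.
apply: (limit_eventually (N := 0%N) _ (limit_sum HF)) => n _.
by rewrite mulr_suml.
Qed.

(** For i <= l the eigenvalue grows like a positive multiple of n^(k-l), while that of index l + 1
    has lower order. For l + 1 < i <= k it is negligible against n^(k-l-1), the order at which index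
    l + 1 is negative. *)
Lemma eberlein_min_eventually (R : realType) (k l : nat) : (l < k)%N ->
  exists N, forall n, (N <= n)%N ->
    (forall i, (i <= k)%N -> eberlein R n k l l.+1 <= eberlein R n k l i) /\
    eberlein R n k l l.+1 < 0.
Proof.
move=> lk; pose ev i n := eberlein R n k l i.
have top := @limit_eberlein_top R k l.
have sub := @limit_eberlein_sub R k l.
have fact_gt0R m : 0 < m`!%:R :> R by rewrite ltr0n fact_gt0.
have subl : limit_O1n (fun n => - ev l.+1 n / n%:R ^+ (k - l - 1))
    (l.+1%:R / (k - l - 1)`!%:R).
  have := limitM (limit_const (-1 : R)) (sub l.+1 (ltnSn l) lk).
  rewrite (subnS k l) -subn1 binn mulr1 !mulN1r mulNr opprK.
  by apply: (limit_eventually (N := 0%N)) => n _; rewrite mulN1r mulNr.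
have pos (u : nat -> R) m c : 0 < c -> limit_O1n (fun n => u n / n%:R ^+ m) c ->
    exists N, forall n, (N <= n)%N -> 0 < u n.
  move=> c0 /(limit_gt0 c0)[N H]; exists (maxn 1 N) => n.
  rewrite geq_max => /andP[n1 /H]; rewrite pmulr_lgt0 // invr_gt0 exprn_gt0 //.
  by rewrite ltr0n.
have ev_i i : exists N, forall n, (N <= n)%N -> (i <= k)%N -> ev l.+1 n <= ev i n.
  case: (ltngtP i l.+1) => [|li|->]; last by exists 0%N.
    rewrite ltnS => il; have [||N H] := pos (fun n => ev i n - ev l.+1 n) (k - l)%N
      ('C(k - i, k - l)%:R / (k - l)`!%:R).
    - by rewrite divr_gt0 // ltr0n bin_gt0; lia.
    - have := limitD (top i) (limitM (limit_const (-1 : R)) (top l.+1)).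
      rewrite (@bin_small (k - l.+1)); last by lia.
      rewrite mul0r mulr0 addr0; apply: (limit_eventually (N := 0%N)) => n _.
      by rewrite mulN1r -mulrBl.
    by exists N => n /H Hn _; rewrite -subr_ge0 ltW.
  have [ik|ki] := leqP i k; last by exists 0%N.
  have [||N H] := pos (fun n => ev i n - ev l.+1 n) (k - l - 1)%N
      (l.+1%:R / (k - l - 1)`!%:R).
  - by rewrite divr_gt0 // ltr0n.
  - have := limitD (sub i (ltnW li) lk) subl.
    rewrite (@bin_small (k - i)); last by lia.
    rewrite mulr0 mul0r add0r; apply: (limit_eventually (N := 0%N)) => n _.
    by rewrite -mulrDl.
  by exists N => n /H Hn _; rewrite -subr_ge0 ltW.
have [|N0 H0] := pos (fun n => - ev l.+1 n) _ _ _ subl.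
  by rewrite divr_gt0 // ltr0n.
suff [N H] : exists N, forall n, (N <= n)%N -> forall i, (i <= k)%N ->
    ev l.+1 n <= ev i n.
  exists (maxn N0 N) => n; rewrite geq_max => /andP[/H0 Hn /H Hn'].
  by split=> //; rewrite -oppr_gt0.
have [N HN] := choice ev_i.
exists (\max_(i < k.+1) N i) => n Nn i ik; apply: HN => //.
by apply: leq_trans Nn;
   apply: (@leq_bigmax _ (fun i : 'I_k.+1 => N i) (Ordinal (ik : i < k.+1)%N)).
Qed.

Theorem theorem4 (R : realType) (k l : nat) (hlk : (l < k)%N) :
  let L := pred1 l in
  let L' := fun m : nat => (m < k)%N && (m != l) in
  (* exact formula for large n *)
  (exists N : nat, forall n : nat, (N <= n)%N ->
     theta_johnson R n k L =
     1 + ('C(k, k - l) * 'C(n - k, k - l))%:R /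
         (\sum_(j < (k - l).+1)
            (-1) ^+ j.+1 * 'C(l.+1, j)%:R * 'C(k - l - 1, k - l - j)%:R
              * 'C(n - k - l - 1, k - l - j)%:R)) /\
  (* theta(G(n,k,L)) = C(k,k-l)/((k-l)(l+1)) n + O(1) *)
  (exists (C : R) (N : nat), forall n : nat, (N <= n)%N ->
     `| theta_johnson R n k L
        - 'C(k, k - l)%:R / ((k - l)%:R * (l.+1)%:R) * n%:R | <= C) /\
  (* theta(G(n,k,L')) = C(n,k) / theta(G(n,k,L)) for large n *)
  (exists N : nat, forall n : nat, (N <= n)%N ->
     theta_johnson R n k L' = 'C(n, k)%:R / theta_johnson R n k L) /\
  (* theta(G(n,k,L')) = (l+1)(k-l)/(k! C(k,k-l)) n^(k-1) + O(n^(k-2)) *)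
  (exists (C : R) (N : nat), forall n : nat, (N <= n)%N ->
     `| theta_johnson R n k L'
        - (l.+1)%:R * (k - l)%:R / (k`!%:R * 'C(k, k - l)%:R) * n%:R ^+ (k - 1) |
       <= C * n%:R ^ (k%:Z - 2)).
Proof.
move=> L L'.
have [N [HL HL']] : exists N, (forall n, (N <= n)%N -> theta_johnson R n k L
      = 1 + eberlein R n k l 0 / - eberlein R n k l l.+1) /\
    (forall n, (N <= n)%N -> theta_johnson R n k L'
      = 'C(n, k)%:R / theta_johnson R n k L).
  have [N H] := eberlein_min_eventually R hlk.
  exists (maxn (k + k + k) N); split=> n; rewrite geq_max => /andP[n3k /H[evm ev0]];
  have [E E'] := theta_johnson_value hlk n3k evm ev0; first exact: E.
  by rewrite /L E E'.
pose c : R := 'C(k, k - l)%:R / ((k - l)%:R * l.+1%:R).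
have fact0R m : m`!%:R != 0 :> R by rewrite pnatr_eq0 -lt0n fact_gt0.
have d0R : (k - l)%:R != 0 :> R by rewrite pnatr_eq0; lia.
have l0R : l.+1%:R != 0 :> R by rewrite pnatr_eq0.
have l1R : 1 + l%:R != 0 :> R by rewrite addrC natr1.
have C0R : 'C(k, k - l)%:R != 0 :> R by rewrite pnatr_eq0 -lt0n bin_gt0 leq_subr.
have c0 : c != 0 by rewrite mulf_neq0 ?invr_eq0 ?mulf_neq0.
(* Divide by n: the quotient D/lam becomes D/n^(k-l) over lam/n^(k-l-1), and the summand 1 becomes
   1/n. *)
have lim1 : limit_O1n (fun n => theta_johnson R n k L / n%:R) c.
  have inv0 : limit_O1n (fun n => 1 / n%:R ^+ 1 : R) 0.
    apply: (limit_lift (ltnSn 0)) (_ : limit_O1n (fun n => 1 / n%:R ^+ 0) 1).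
    by apply: (limit_eventually (N := 0%N) _ (limit_const 1)) => n _; rewrite expr0 divr1.
  have lamE : - (- l.+1%:R * 'C(k - l.+1, k - l - 1)%:R / (k - l - 1)`!%:R)
      = l.+1%:R / (k - l - 1)`!%:R :> R.
    by rewrite (subnS k l) -subn1 binn mulr1 mulNr opprK.
  have := limitM (limit_const (-1 : R)) (limit_eberlein_sub R (ltnSn l) hlk).
  rewrite mulN1r lamE => lam.
  have lam0 : l.+1%:R / (k - l - 1)`!%:R != 0 :> R by rewrite mulf_neq0 ?invr_eq0.
  have := limitD inv0 (limitM (limit_eberlein_top R k l 0) (limitV lam0 lam)).
  have -> : 0 + 'C(k - 0, k - l)%:R / (k - l)`!%:R * (l.+1%:R / (k - l - 1)`!%:R)^-1 = c.
    have -> : (k - l)`! = ((k - l) * (k - l - 1)`!)%N.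
      by rewrite subn1; case: (k - l)%N (subn_gt0 l k) => [|d]; rewrite ?hlk // factS.
    by rewrite natrM subn0 add0r /c; field; rewrite !fact0R d0R l1R.
  apply: (limit_eventually (N := maxn 1 N)) => n; rewrite geq_max => /andP[n1 Nn].
  rewrite HL //.
  have n0 : n%:R != 0 :> R by rewrite pnatr_eq0 -lt0n.
  have -> : n%:R ^+ (k - l) = n%:R * n%:R ^+ (k - l - 1) :> R.
    by rewrite -exprS; congr (_ ^+ _); lia.
  rewrite mulN1r -mulNr [(- _ / _)^-1]invfM invrK expr1.
  by move: (- eberlein R n k l l.+1)^-1 => w; field; rewrite n0 expf_neq0.
have lim2 : limit_O1n (fun n => theta_johnson R n k L' / n%:R ^+ (k - 1))
    (l.+1%:R * (k - l)%:R / (k`!%:R * 'C(k, k - l)%:R)).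
  have bin : limit_O1n (fun n => 'C(n, k)%:R / n%:R ^+ k : R) (k`!%:R)^-1.
    apply: (limit_eventually (N := 0%N)) (limit_binomial R 0 k) => n _.
    by rewrite subn0.
  have := limitM bin (limitV c0 lim1).
  have -> : (k`!%:R)^-1 * c^-1 = l.+1%:R * (k - l)%:R / (k`!%:R * 'C(k, k - l)%:R).
    by rewrite /c; field; rewrite !fact0R d0R C0R l1R.
  apply: (limit_eventually (N := maxn 1 N)) => n; rewrite geq_max => /andP[n1 Nn].
  rewrite HL' // invfM invrK.
  have n0 : n%:R != 0 :> R by rewrite pnatr_eq0 -lt0n.
  have -> : n%:R ^+ k = n%:R * n%:R ^+ (k - 1) :> R.
    by rewrite -exprS; congr (_ ^+ _); lia.
  by move: (theta_johnson R n k L)^-1 => w; field; rewrite n0 expf_neq0.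
split; [|split; [|split]].
- exists N => n Nn; rewrite HL // eberlein0; congr (_ + _ / _).
  rewrite /eberlein -sumrN; apply: eq_bigr => j _.
  rewrite exprS mulN1r !mulNr (subnS k l) -subn1 (_ : (n - k - l.+1 = n - k - l - 1)%N) //.
  by lia.
- have [C [N' H]] := lim1; exists C, (maxn 1 N') => n.
  rewrite geq_max => /andP[n1 /H Hn].
  have n0 : n%:R != 0 :> R by rewrite pnatr_eq0 -lt0n.
  apply: le_trans Hn; rewrite -[X in _ <= _ * X]normr_nat -normrM mulrBl divfK //.
- by exists N.
- have [C [N' H]] := lim2; exists C, (maxn 1 N') => n.
  rewrite geq_max => /andP[n1 /H Hn].
  have n0 : n%:R != 0 :> R by rewrite pnatr_eq0 -lt0n.
  have n_gt0 : 0 < n%:R :> R by rewrite ltr0n.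
  (* The exponent is an integer because it is -1 when k = 1. *)
  have -> : n%:R ^ (k%:Z - 2) = n%:R ^+ (k - 1) / n%:R :> R.
    have -> : k%:Z - 2 = (k - 1)%N%:Z - 1 by lia.
    by rewrite expfzDr // expN1r.
  have p0 : 0 < n%:R ^+ (k - 1) :> R by rewrite exprn_gt0.
  rewrite mulrA ler_pdivlMr // -ler_pdivrMr // mulrAC.
  apply: le_trans Hn; rewrite ler_wpM2r //.
  have pE : theta_johnson R n k L' / n%:R ^+ (k - 1)
      - l.+1%:R * (k - l)%:R / (k`!%:R * 'C(k, k - l)%:R)
    = (theta_johnson R n k L' - l.+1%:R * (k - l)%:R / (k`!%:R * 'C(k, k - l)%:R)
        * n%:R ^+ (k - 1)) / n%:R ^+ (k - 1).
    by rewrite mulrBl mulfK // gt_eqF.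
  by rewrite pE normrM normfV (gtr0_norm p0).
Qed.
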